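(* Let $K$ be a field of characteristic zero and $S=K[x_1,x_2,x_3]$. Let $d_1,d_2,d_3$ be positive integers and let $f_1,f_2,f_3\in S$ be a regular sequence of homogeneous polynomials of degrees $d_1,d_2,d_3$ respectively. Put $I=(f_1,f_2,f_3)$ and suppose that $S/I$ has the strong Lefschetz property. Then $J=\operatorname{Gin}(I)$ is uniquely determined, i.e. it depends only on $(d_1,d_2,d_3)$: if $f_1',f_2',f_3'$ is another regular sequence of homogeneous polynomials of degrees $d_1,d_2,d_3$ with $I'=(f_1',f_2',f_3')$ and $S/I'$ having the strong Lefschetz property, then $\operatorname{Gin}(I')=\operatorname{Gin}(I)$. Moreover, $J$ is an almost reverse lexicographic ideal.
   Context: The monomial order is the reverse lexicographic order with $x_1>x_2>x_3$: for monomials of the same degree, $x^a>x^b$ iff the last nonzero entry of $a-b$ is negative. $\operatorname{Gin}(I)$ denotes the generic initial ideal of $I$ with respect to this order, i.e. the initial ideal $\operatorname{in}(g(I))$ for $g$ in a nonempty Zariski open subset of $GL_3(K)$ acting by linear change of variables. For $A=S/I$ artinian graded, $A$ has the strong Lefschetz property if there is a linear form $\ell\in S$ such that for every integer $b\ge 1$ and every $t\ge 0$ the multiplication map $A_t\xrightarrow{\cdot \ell^b}A_{t+b}$ is injective or surjective. A monomial ideal $J$ is almost reverse lexicographic if whenever $u$ is a minimal monomial generator of $J$ and $v$ is a monomial with $\deg v=\deg u$ and $v>u$ in the reverse lexicographic order, then $v\in J$. *)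

(* Defs.v *)
From HB Require Import structures.
From mathcomp Require Import all_boot all_order all_algebra.
From mathcomp Require Import mpoly.

Set Implicit Arguments.
Unset Strict Implicit.
Unset Printing Implicit Defensive.

Import Order.TTheory GRing.Theory.
Local Open Scope ring_scope.

(* Variables x_1,x_2,x_3 are 'X_0,'X_1,'X_2 (indices 'I_3). *)
Section Defs.
Variable K : fieldType.
Local Notation S := {mpoly K[3]}.

(* ideals of S are represented by their membership predicate *)
Definition ideal_first (f : 'I_3 -> S) (k : nat) (p : S) : Prop :=
  exists c : 'I_3 -> S, p = \sum_(i < 3 | (i < k)%N) c i * f i.

Definition ideal3 (f : 'I_3 -> S) (p : S) : Prop := ideal_first f 3 p.

Definition regular_seq3 (f : 'I_3 -> S) : Prop :=
  (forall (k : 'I_3) (g : S), ideal_first f k (g * f k) -> ideal_first f k g)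
  /\ ~ ideal3 f 1.

(* Strong Lefschetz property of A = S/I, I homogeneous:
   some linear form l such that for all b >= 1, t >= 0, the map
   A_t -> A_{t+b}, multiplication by l^b, is injective or surjective. *)
Definition mult_injective (I : S -> Prop) (l : S) (b t : nat) : Prop :=
  forall g : S, g \is t.-homog -> I (g * l ^+ b) -> I g.

Definition mult_surjective (I : S -> Prop) (l : S) (b t : nat) : Prop :=
  forall h : S, h \is (t + b)%N.-homog ->
    exists g : S, g \is t.-homog /\ I (h - g * l ^+ b).

Definition strong_Lefschetz (I : S -> Prop) : Prop :=
  exists l : S, l \is 1%N.-homog /\
    forall b t : nat, (0 < b)%N ->
      mult_injective I l b t \/ mult_surjective I l b t.

(* reverse lexicographic order with x_1 > x_2 > x_3 (on monomials of the
   same degree): x^a > x^b iff the last nonzero entry of a - b is negative *)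
Definition revlex_gt (a b : 'X_{1..3}) : bool :=
  [exists i : 'I_3, (a i < b i)%N && [forall j : 'I_3, (i < j)%N ==> (a j == b j)]].

Definition is_lead_mono (p : S) (m : 'X_{1..3}) : Prop :=
  p@_m != 0 /\ forall m' : 'X_{1..3}, p@_m' != 0 -> m' != m -> revlex_gt m m'.

(* monomial ideals are represented by the set of monomials they contain;
   in(I) = ideal generated by leading monomials of homogeneous elements *)
Definition initial_ideal (I : S -> Prop) (m : 'X_{1..3}) : Prop :=
  exists p : S, I p /\ (exists e : nat, p \is e.-homog) /\ p != 0 /\ is_lead_mono p m.

Definition lin_change (g : 'M[K]_3) (p : S) : S :=
  p \mPo [tuple \sum_(j < 3) g i j *: 'X_j | i < 3].

Definition image_ideal (g : 'M[K]_3) (I : S -> Prop) (q : S) : Prop :=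
  exists p : S, I p /\ q = lin_change g p.

(* J = Gin(I): there is a nonempty Zariski open subset of GL_3(K),
   namely {g in GL_3 | P(g) <> 0} with P a nonzero polynomial in the 9
   matrix entries, on which in(g(I)) = J. *)
Definition is_gin (I : S -> Prop) (J : 'X_{1..3} -> Prop) : Prop :=
  exists P : {mpoly K[3 * 3]}, P != 0 /\
    forall g : 'M[K]_3, g \in unitmx -> P.@[fun k => mxvec g 0 k] != 0 ->
      forall m, J m <-> initial_ideal (image_ideal g I) m.

Definition min_gen (J : 'X_{1..3} -> Prop) (u : 'X_{1..3}) : Prop :=
  J u /\ forall v : 'X_{1..3}, J v -> (forall i, (v i <= u i)%N) -> v = u.

Definition almost_revlex (J : 'X_{1..3} -> Prop) : Prop :=
  forall u v : 'X_{1..3}, min_gen J u -> mdeg v = mdeg u -> revlex_gt v u -> J v.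

End Defs.

(* Main.v *)
(** Write [h] for the Hilbert function of [S/I]; additivity along the regular sequence shows that
    it depends only on the degrees [d_i].  If [V = g(I)] for a general [g], then multiplication by
    [x_3^c] has maximal rank on [S/V] in every degree (strong Lefschetz property), so the dimension
    of [V_t] intersected with [(x_3^c)] is a function [e(t, c)] of [h].  Hence in degree [t] the
    initial ideal contains [r = e(t, c) - e(t, c + 1)] monomials of exact [x_3]-degree [c].  After a
    general shear [x_2 -> x_2 + s x_1] these are the [r] largest ones: otherwise a nonzero element
    of an [r]-dimensional space of univariate polynomials would vanish to order [r] at a general
    point [s], which Wronskians exclude in characteristic zero.  Each of these conditions is open in
    [g], and there are finitely many, since [h] vanishes in large degrees.

    For the almost reverse lexicographic property, let [x_1^a x_2^b x_3^c] with [c > 0] be a minimal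
    generator of degree [t].  Unimodality of [h] (again Lefschetz) shows that either
    [h t <= h (t - c)], and then all monomials of degree [t] and smaller [x_3]-degree lie in the
    initial ideal, or [x_1^a x_2^b x_3^(c-1)] lies in it as well, against minimality. *)
Require Import Defs.
From HB Require Import structures.
From mathcomp Require Import all_boot all_order all_algebra.
From mathcomp Require Import perm mpoly.
From mathcomp Require Import zify ring.
From Stdlib Require Import Classical ClassicalEpsilon.

Set Implicit Arguments.
Unset Strict Implicit.
Unset Printing Implicit Defensive.

Import GRing.Theory.
Local Open Scope ring_scope.

(** * Graded pieces of linear subsets of the polynomial ring, and their dimensions *)

Section Graded.
Variable K : fieldType.
Local Notation S := {mpoly K[3]}.
Local Notation H := (dhomog 3 K).

(** Among the subspaces contained in [P] one has maximal dimension, and adding the line of a further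
    element of [P] would give a larger one. The predicate is [Prop]-valued, so the argument is
    classical. *)
Lemma vspace_of_pred (vT : vectType K) (P : vT -> Prop) :
  P 0 -> (forall a u v, P u -> P v -> P (a *: u + v)) ->
  exists U : {vspace vT}, forall v, v \in U <-> P v.
Proof.
move=> P0 PD.
have [k [U [UP dU] maxU]] : exists2 k, exists U : {vspace vT},
    (forall v, v \in U -> P v) /\ \dim U = k &
    forall U : {vspace vT}, (forall v, v \in U -> P v) -> (\dim U <= k)%N.
  apply: NNPP => noU.
  have /(_ (dim vT).+1) [U [_ dU]] : forall k, exists U : {vspace vT},
      (forall v, v \in U -> P v) /\ (k <= \dim U)%N.
    elim=> [|k [U [UP dU]]].
      by exists 0%VS; split=> // v; rewrite memv0 => /eqP ->.
    apply: NNPP => noS; apply: noU; exists k.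
      exists U; split=> //; apply/eqP; rewrite eqn_leq dU andbT leqNgt.
      by apply/negP => lt; apply: noS; exists U.
    move=> W WP; rewrite leqNgt; apply/negP => lt; apply: noS.
    by exists W.
  have := dimvS (subvf U); rewrite dimvf => le.
  by have := leq_trans dU le; rewrite ltnn.
exists U => v; split; first exact: UP.
move=> Pv; have le : (U + <[v]> <= U)%VS.
  rewrite -(dimv_leqif_sup (addvSl U <[v]>)).2 eqn_leq dimvS ?addvSl //= dU.
  apply: maxU => w /memv_addP [u Uu [_ /vlineP [c ->] ->]].
  by rewrite addrC; apply: PD => //; apply: UP.
by apply: (subvP le); rewrite memvE addvSr.
Qed.

Definition linpred (P : S -> Prop) :=
  P 0 /\ forall (a : K) u v, P u -> P v -> P (a *: u + v).

Lemma linpredD P u v : linpred P -> P u -> P v -> P (u + v).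
Proof. by case=> _ PD Pu Pv; rewrite -[u]scale1r; apply: PD. Qed.

Lemma linpredZ P a u : linpred P -> P u -> P (a *: u).
Proof. by case=> P0 PD Pu; rewrite -[_ *: _]addr0; apply: PD. Qed.

Lemma linpredB P u v : linpred P -> P u -> P v -> P (u - v).
Proof. by move=> lP Pu Pv; rewrite -scaleN1r; apply: linpredD (linpredZ _ lP _). Qed.

Lemma linpred_sum P I (r : seq I) (Q : pred I) F :
  linpred P -> (forall i, Q i -> P (F i)) -> P (\sum_(i <- r | Q i) F i).
Proof. by move=> lP PF; apply: big_ind => //; [case: lP | move=> *; apply: linpredD]. Qed.

Lemma linpredI P Q : linpred P -> linpred Q -> linpred (fun p => P p /\ Q p).
Proof. by case=> P0 PD [Q0 QD]; split=> // a u v [? ?] [? ?]; split; auto. Qed.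

Lemma linpredT : linpred (fun _ => True).
Proof. by []. Qed.

Lemma linpred_comp (f : {linear S -> S}) P : linpred P -> linpred (fun p => P (f p)).
Proof.
by case=> P0 PD; split=> [|a u v Pu Pv]; rewrite ?linear0 ?linearP //; apply: PD.
Qed.

(** The degree [n] part of [P] as a genuine subspace, obtained by choice because [P] is only a
    [Prop]; it has this meaning when [linpred P] holds. *)
Definition gp (P : S -> Prop) n : {vspace H n} :=
  epsilon (inhabits 0%VS) (fun U => forall v : H n, v \in U <-> P (val v)).

Lemma gpP P n (v : H n) : linpred P -> v \in gp P n <-> P (val v).
Proof.
case=> P0 PD; have := epsilon_spec (inhabits (0%VS : {vspace H n}))
  (fun U => forall v : H n, v \in U <-> P (val v)).
move=> -> //; apply: vspace_of_pred => [|a u w]; rewrite ?raddf0 //.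
exact: PD.
Qed.

Definition dimp P n := \dim (gp P n).

Definition dimS n := \dim {:H n}.

Lemma dimSE n : dimS n = 'C(n.+2, 2).
Proof. by rewrite /dimS dimvf /dim /= -bin_sub ?leq_addr // addKn addn2. Qed.

Lemma dimS_S n : dimS n.+1 = (dimS n + n.+2)%N.
Proof. by rewrite !dimSE binS bin1. Qed.

Lemma dimp_leS P n : (dimp P n <= dimS n)%N.
Proof. by apply: dimvS; apply: subvf. Qed.

Lemma dimp_le P Q n : linpred P -> linpred Q ->
  (forall p, p \is n.-homog -> P p -> Q p) -> (dimp P n <= dimp Q n)%N.
Proof.
move=> lP lQ PQ; apply/dimvS/subvP => v /gpP-/(_ lP) Pv.
by apply/gpP => //; apply: PQ => //; apply: dhomog_is_dhomog.
Qed.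

Lemma dimp_eq P Q n : linpred P -> linpred Q ->
  (forall p, p \is n.-homog -> (P p <-> Q p)) -> dimp P n = dimp Q n.
Proof.
by move=> lP lQ PQ; apply/eqP; rewrite eqn_leq !dimp_le // => p hp /PQ; auto.
Qed.

Lemma dimp_le_sub P Q n : linpred P -> linpred Q ->
  (forall p, p \is n.-homog -> P p -> Q p) -> (dimp Q n <= dimp P n)%N ->
  forall p, p \is n.-homog -> Q p -> P p.
Proof.
move=> lP lQ PQ dQP p hp Qp.
have sPQ : (gp P n <= gp Q n)%VS.
  by apply/subvP => v /gpP-/(_ lP) Pv; apply/gpP => //; apply: PQ => //; apply: dhomog_is_dhomog.
have sQP : (gp Q n <= gp P n)%VS.
  by rewrite -(dimv_leqif_sup sPQ).2 eqn_leq dimvS.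
apply: (proj1 (gpP (DHomog hp) lP)); apply: (subvP sQP).
exact/gpP.
Qed.

Lemma gpI P Q n : linpred P -> linpred Q ->
  gp (fun p => P p /\ Q p) n = (gp P n :&: gp Q n)%VS.
Proof.
move=> lP lQ; apply/vspaceP => v; have lPQ := linpredI lP lQ.
apply/idP/memv_capP => [/gpP-/(_ lPQ) [Pv Qv]|[/gpP-/(_ lP) Pv /gpP-/(_ lQ) Qv]].
  by split; apply/gpP.
exact/gpP.
Qed.

Lemma dimpI_ge P Q n : linpred P -> linpred Q ->
  (dimp P n + dimp Q n <= dimS n + dimp (fun p => P p /\ Q p) n)%N.
Proof.
by move=> lP lQ; rewrite /dimp gpI // -dimv_sum_cap leq_add2r dimvS ?subvf.
Qed.

Lemma dimpT n : dimp (fun _ => True) n = dimS n.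
Proof. by congr (\dim _); apply/vspaceP => v; rewrite memvf; apply/gpP. Qed.

Lemma dimp_full P n : linpred P -> (dimS n <= dimp P n)%N ->
  forall p, p \is n.-homog -> P p.
Proof.
move=> lP le p hp; apply: (dimp_le_sub lP linpredT _ _ hp) => //.
by rewrite dimpT.
Qed.

Section GradedMap.
Variables (f : {linear S -> S}) (n m : nat).
Hypothesis f_homog : forall p, p \is n.-homog -> f p \is m.-homog.

Definition hmap (v : H n) : H m := DHomog (f_homog (dhomog_is_dhomog v)).

Fact hmap_is_linear : linear hmap.
Proof. by move=> a u v; apply: val_inj; rewrite /= linearP. Qed.

HB.instance Definition _ := GRing.isLinear.Build K (H n) (H m) _ hmap hmap_is_linear.

Definition hfun : 'Hom(H n, H m) := linfun hmap.

Lemma hfunE v : val (hfun v) = f (val v).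
Proof. by rewrite lfunE. Qed.

Hypothesis f_inj : forall p, p \is n.-homog -> f p = 0 -> p = 0.

Lemma hfun_ker0 : lker hfun == 0%VS.
Proof.
rewrite -subv0; apply/subvP => v; rewrite memv_ker memv0 => /eqP fv0.
by apply/eqP/val_inj/f_inj; [apply: dhomog_is_dhomog | rewrite -hfunE fv0].
Qed.

(** Transport of dimension along a graded injective map; it serves both for multiplication by a form
    and for changes of coordinates. *)
Lemma dimp_map_eq P Q : linpred P -> linpred Q ->
  (forall p, p \is n.-homog -> P p -> Q (f p)) ->
  (forall q, q \is m.-homog -> Q q -> exists2 p, p \is n.-homog & P p /\ q = f p) ->
  dimp P n = dimp Q m.
Proof.
move=> lP lQ PQ QP; rewrite /dimp -(@limg_dim_eq _ _ _ hfun); last first.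
  by rewrite (eqP hfun_ker0) capv0.
congr (\dim _); apply/vspaceP => w; apply/memv_imgP/idP.
  case=> v /gpP-/(_ lP) Pv ->; apply/gpP; rewrite // hfunE.
  by apply: PQ => //; apply: dhomog_is_dhomog.
move/gpP => /(_ lQ) Qw; have [|//|p hp [Pp E]] := QP (val w); first exact: dhomog_is_dhomog.
exists (DHomog hp); first exact/gpP.
by apply: val_inj; rewrite hfunE.
Qed.

End GradedMap.

End Graded.

(** * Hilbert functions along a regular sequence *)

Section RegularSequence.
Variable K : fieldType.
Local Notation S := {mpoly K[3]}.
Local Notation "''pi_' n p" := (pihomog mdeg n p) (at level 8, n, p at level 2).

Lemma pihomogM n e (p q : S) : q \is e.-homog ->
  'pi_(n + e) (p * q) = 'pi_n p * q.
Proof.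
move=> hq; rewrite [in LHS](mpolyE p) [in RHS](mpolyE p) mulr_suml !linear_sum.
rewrite mulr_suml; apply: eq_bigr => m _.
rewrite -scalerAl !linearZ /= -scalerAl; congr (_ *: _).
have hm : 'X_[K, m] * q \is (mdeg m + e).-homog.
  by apply: dhomogM; rewrite ?dhomogX.
rewrite pihomogX; case: eqP => [<-|/eqP ne].
  by rewrite pihomog_dE.
by rewrite mul0r (pihomog_ne0 _ hm) // eqn_add2r.
Qed.

Lemma pihomogM_lt n e (p q : S) : (n < e)%N -> q \is e.-homog -> 'pi_n (p * q) = 0.
Proof.
move=> lt hq; rewrite (mpolyE p) mulr_suml linear_sum big1 // => m _.
rewrite -scalerAl linearZ /=.
have hm : 'X_[K, m] * q \is (mdeg m + e).-homog.
  by apply: dhomogM; rewrite ?dhomogX.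
by rewrite (pihomog_ne0 _ hm) ?scaler0 //; lia.
Qed.

(** Compare the components of degree [n + e] of the product and cancel [q]. *)
Lemma homog_div n e (p q : S) : q != 0 -> q \is e.-homog ->
  p * q \is (n + e).-homog -> p \is n.-homog.
Proof.
move=> q0 hq /pihomog_dE; rewrite pihomogM // => /(mulIf q0) <-.
exact: pihomogP.
Qed.

Definition mulby (q p : S) : S := p * q.

Fact mulby_is_linear q : linear (mulby q).
Proof. by move=> a u v; rewrite /mulby mulrDl scalerAl. Qed.

HB.instance Definition _ q := GRing.isLinear.Build K S S _ (mulby q) (mulby_is_linear q).

Definition multiple (q p : S) := exists r, p = r * q.

Lemma linpred_multiple q : linpred (multiple q).
Proof.
split=> [|a _ _ [r ->] [s ->]]; first by exists 0; rewrite mul0r.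
by exists (a *: r + s); rewrite mulrDl scalerAl.
Qed.

Lemma linpred_colon P q : linpred P -> linpred (fun p : S => P (p * q)).
Proof. exact: (linpred_comp (mulby q)). Qed.

(** Multiplication by [q] maps the colon space of [P] by [q] isomorphically onto the multiples of
    [q] in [P]; kernels of multiplication maps are measured this way, without quotient rings. *)
Lemma dimp_colon P e (q : S) n : q != 0 -> q \is e.-homog -> linpred P ->
  dimp (fun p => P (p * q)) n = dimp (fun p => P p /\ multiple q p) (n + e).
Proof.
move=> q0 hq lP; apply: (@dimp_map_eq _ (mulby q)).
- by move=> p hp; apply: dhomogM.
- by move=> p _ /eqP; rewrite mulf_eq0 (negbTE q0) orbF => /eqP.
- exact: linpred_colon.
- exact/linpredI/linpred_multiple.
- by move=> p _ Pp; split=> //; exists p.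
- move=> p hp [Pp [r E]]; exists r; last by rewrite -E.
  by apply: (homog_div q0 hq); rewrite -E.
Qed.

Lemma dimp_multiple e (q : S) n : q != 0 -> q \is e.-homog ->
  dimp (multiple q) (n + e) = dimS K n.
Proof.
move=> q0 hq; rewrite -dimpT (dimp_colon n q0 hq (@linpredT K)).
apply: dimp_eq => [||p _]; try exact: linpred_multiple.
  exact/linpredI/linpred_multiple/linpredT.
by split=> [|[]].
Qed.

Lemma linpred_ideal_first (f : 'I_3 -> S) k : linpred (ideal_first f k).
Proof.
split=> [|a _ _ [c ->] [c' ->]].
  by exists (fun _ => 0); rewrite big1 // => i _; rewrite mul0r.
exists (fun i => a *: c i + c' i); rewrite scaler_sumr -big_split /=.
by apply: eq_bigr => i _; rewrite mulrDl scalerAl.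
Qed.

Lemma ideal_firstM (f : 'I_3 -> S) k p q : ideal_first f k p -> ideal_first f k (q * p).
Proof.
case=> c ->; exists (fun i => q * c i); rewrite mulr_sumr.
by apply: eq_bigr => i _; rewrite mulrA.
Qed.

Lemma ideal_first_pihomog (f : 'I_3 -> S) (d : 'I_3 -> nat) k n p :
  (forall i, f i \is (d i).-homog) -> ideal_first f k p -> ideal_first f k ('pi_n p).
Proof.
move=> hf [c ->]; rewrite linear_sum /=.
exists (fun i => if (d i <= n)%N then 'pi_(n - d i) (c i) else 0).
apply: eq_bigr => i _; case: leqP => le; last first.
  by rewrite mul0r (pihomogM_lt _ le).
by have := pihomogM (n - d i) (c i) (hf i); rewrite subnK.
Qed.

Lemma ideal_first_recr (f : 'I_3 -> S) (k : 'I_3) p :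
  ideal_first f k.+1 p <-> exists u r, ideal_first f k u /\ p = u + r * f k.
Proof.
split=> [[c ->]|[u [r [[c ->] ->]]]].
  exists (\sum_(i < 3 | (i < k)%N) c i * f i), (c k); split; first by exists c.
  rewrite (bigD1 k) //= addrC; congr (_ + _); apply: eq_bigl => i.
  by rewrite -val_eqE /=; lia.
exists (fun i => if i == k then r else c i).
rewrite [RHS](bigD1 k) //= eqxx addrC; congr (_ + _).
apply: eq_big => i; first by rewrite -val_eqE /=; lia.
by rewrite -val_eqE /=; case: eqP => // ->; rewrite ltnn.
Qed.

(** The Hilbert function of the quotient by [P]; the subtraction never truncates, by [dimp_leS]. *)
Definition hilb (P : S -> Prop) n := (dimS K n - dimp P n)%N.

Lemma dimp_hilb P n : (dimp P n + hilb P n = dimS K n)%N.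
Proof. by rewrite subnKC // dimp_leS. Qed.

Section HilbertFunction.
Variables (d : 'I_3 -> nat) (f : 'I_3 -> S).
Hypotheses (hf : forall i, f i \is (d i).-homog) (hreg : regular_seq3 f).

(** If [f k] were zero, regularity applied to [g = 1] would put [1] in the ideal of the earlier
    terms. *)
Lemma regular_neq0 k : f k != 0.
Proof.
apply/eqP => fk0; apply: hreg.2.
have [c E] : ideal_first f k 1.
  by apply: hreg.1; rewrite fk0 mulr0; case: (linpred_ideal_first f k).
exists (fun i : 'I_3 => if (i < k)%N then c i else 0).
rewrite {}E [LHS]big_mkcond [RHS]big_mkcond /=; apply: eq_bigr => i _.
by case: ifP; rewrite ?mul0r ltn_ord.
Qed.

(** Write F for the ideal of the first [k] terms. The next ideal is F + (f_k), and the intersection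
    of F with (f_k) is a shifted copy of the colon ideal of F by f_k, so the dimension formula for
    sums applies. *)
Lemma hilb_ideal_firstS (k : 'I_3) n :
  (hilb (ideal_first f k.+1) (n + d k) + hilb (ideal_first f k) n =
   hilb (ideal_first f k) (n + d k))%N.
Proof.
have [lk lS] := (linpred_ideal_first f k, linpred_ideal_first f k.+1).
have lM := linpred_multiple (f k).
have f0 := regular_neq0 k.
have E1 : gp (ideal_first f k.+1) (n + d k) =
          (gp (ideal_first f k) (n + d k) + gp (multiple (f k)) (n + d k))%VS.
  apply/vspaceP => v; apply/idP/memv_addP.
    move/gpP => /(_ lS) /ideal_first_recr [u [r [Fu E]]].
    have {}E := congr1 (pihomog mdeg (n + d k)) E.
    rewrite pihomog_dE ?dhomog_is_dhomog // linearD /= pihomogM // in E.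
    exists (DHomog (pihomogP mdeg (n + d k) u)).
      by apply/gpP; rewrite //=; apply: (ideal_first_pihomog _ hf).
    have hr : 'pi_n r * f k \is (n + d k).-homog by apply: dhomogM; rewrite ?pihomogP.
    exists (DHomog hr); first by apply/gpP => //=; exists ('pi_n r).
    exact: val_inj.
  case=> u /gpP-/(_ lk) Fu [w /gpP-/(_ lM) [r E] ->].
  by apply/gpP => //; apply/ideal_first_recr; exists (val u), r; rewrite /= -E.
have := dimv_sum_cap (gp (ideal_first f k) (n + d k)) (gp (multiple (f k)) (n + d k)).
rewrite -E1 -gpI // -!/(dimp _ _) (dimp_multiple _ f0 (hf k)).
rewrite -(dimp_colon n f0 (hf k) lk).
(* Regularity says that the colon ideal by [f k] is the ideal itself. *)
rewrite (@dimp_eq _ _ (ideal_first f k) n) //; first last.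
- by move=> p _; split=> [/(hreg.1 _ _)//|Fp]; rewrite mulrC; apply: ideal_firstM.
- exact: linpred_colon.
have := dimp_hilb (ideal_first f k) n.
have := dimp_hilb (ideal_first f k) (n + d k).
have := dimp_hilb (ideal_first f k.+1) (n + d k).
lia.
Qed.

Lemma hilb_ideal_first_lt (k : 'I_3) n : (n < d k)%N ->
  hilb (ideal_first f k.+1) n = hilb (ideal_first f k) n.
Proof.
move=> lt; congr (_ - _)%N.
apply: dimp_eq => [||p hp]; try exact: linpred_ideal_first.
split=> [/ideal_first_recr [u [r [Fu E]]]|Fp].
  move: hp => /pihomog_dE; rewrite E linearD /= (pihomogM_lt _ lt (hf k)) addr0.
  by rewrite -E => <-; apply: (ideal_first_pihomog _ hf).
by apply/ideal_first_recr; exists p, 0; rewrite mul0r addr0.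
Qed.

Lemma hilb_ideal_first0 n : hilb (ideal_first f 0%N) n = dimS K n.
Proof.
suff: dimp (ideal_first f 0%N) n = 0%N by rewrite /hilb => ->; rewrite subn0.
apply/eqP; rewrite dimv_eq0 -subv0; apply/subvP => v.
move/gpP => /(_ (linpred_ideal_first f 0)) [c]; rewrite big_pred0 // => E.
by rewrite memv0; apply/eqP/val_inj.
Qed.

(** The additivity relations make this value a third difference, with steps d_1, d_2, d_3, of the
    quadratic polynomial [dimS]. The bound on [n] keeps all eight arguments nonnegative. *)
Lemma hilb_ideal3_eq0 n : (\sum_i d i <= n)%N -> hilb (ideal3 f) n = 0%N.
Proof.
pose i0 := @Ordinal 3 0 isT; pose i1 := @Ordinal 3 1 isT; pose i2 := @Ordinal 3 2 isT.
have -> : (\sum_i d i = d i0 + (d i1 + d i2))%N.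
  by rewrite !big_ord_recl big_ord0 addn0; congr (d _ + (d _ + d _))%N; apply: val_inj.
move=> le; pose F := ideal_first f.
have [m ->] : exists m, n = (m + d i0 + d i1 + d i2)%N.
  by exists (n - (d i0 + (d i1 + d i2)))%N; lia.
have H0 := hilb_ideal_first0.
have H1 n' : (hilb (F 1%N) (n' + d i0) + dimS K n' = dimS K (n' + d i0))%N.
  by rewrite -!H0; exact: (hilb_ideal_firstS i0).
have H2 n' : (hilb (F 2%N) (n' + d i1) + hilb (F 1%N) n' = hilb (F 1%N) (n' + d i1))%N.
  exact: (hilb_ideal_firstS i1).
have H3 n' : (hilb (F 3%N) (n' + d i2) + hilb (F 2%N) n' = hilb (F 2%N) (n' + d i2))%N.
  exact: (hilb_ideal_firstS i2).
have E n' : (2 * dimS K n' = n'.+2 * n'.+1)%N.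
  by rewrite dimSE -(mul_bin_diag n'.+2 1) bin1.
have := (H3 (m + d i0 + d i1)%N).
have := (H2 (m + d i0)%N, H2 (m + d i0 + d i2)%N).
have := (H1 m, H1 (m + d i1)%N, H1 (m + d i2)%N, H1 (m + d i1 + d i2)%N).
have A1 : (m + d i1 + d i0 = m + d i0 + d i1)%N by lia.
have A2 : (m + d i2 + d i0 = m + d i0 + d i2)%N by lia.
have A3 : (m + d i1 + d i2 + d i0 = m + d i0 + d i1 + d i2)%N by lia.
have A4 : (m + d i0 + d i2 + d i1 = m + d i0 + d i1 + d i2)%N by lia.
rewrite -[ideal3 f]/(F 3%N) A1 A2 A3 A4.
have := (E m, E (m + d i0), E (m + d i1), E (m + d i2), E (m + d i0 + d i1),
         E (m + d i0 + d i2), E (m + d i1 + d i2), E (m + d i0 + d i1 + d i2))%N.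
move=> [[[[[[[E1 E2] E3] E4] E5] E6] E7] E8] [[[h1 h2] h3] h4] [h5 h6] h7.
lia.
Qed.
End HilbertFunction.

End RegularSequence.

(** * Nonvanishing points and Wronskians in characteristic zero *)

Section CharacteristicZero.
Variable K : fieldType.
Hypothesis K0 : [pchar K] =i pred0.

Lemma natr_inj_pchar0 : injective (fun n : nat => n%:R : K).
Proof.
have wlog_le n m : (n <= m)%N -> n%:R = m%:R :> K -> n = m.
  move=> le /eqP; rewrite eq_sym -subr_eq0 -natrB // (pcharf0P K).1 //; lia.
by move=> n m E; case: (leqP n m) => [|/ltnW] le; [|symmetry]; apply: wlog_le.
Qed.

Lemma poly_nonroot (p : {poly K}) : p != 0 -> exists x, p.[x] != 0.
Proof.
move=> p0; pose s : seq K := [seq n%:R | n <- iota 0 (size p)].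
have Us : uniq s by rewrite map_inj_uniq ?iota_uniq //; apply: natr_inj_pchar0.
have : ~~ all (root p) s.
  apply/negP => rs; have := max_poly_roots p0 rs Us.
  by rewrite size_map size_iota ltnn.
by case/allPn => x _ px; exists x.
Qed.

(** Uniqueness of base [N] digits, which keeps distinct monomials apart under Kronecker
    substitution. *)
Lemma digits_inj N n (a b : 'I_n -> nat) :
  (forall i, a i < N)%N -> (forall i, b i < N)%N ->
  (\sum_i a i * N ^ i = \sum_i b i * N ^ i)%N -> a =1 b.
Proof.
elim: n a b => [|n IH] a b ha hb; first by move=> _ [].
rewrite !big_ord_recl !expn0 !muln1.
have shift (c : 'I_n.+1 -> nat) : (\sum_(i < n) c (lift ord0 i) * N ^ lift ord0 i =
    (\sum_(i < n) c (lift ord0 i) * N ^ i) * N)%N.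
  by rewrite big_distrl /=; apply: eq_bigr => i _; rewrite expnSr mulnA.
rewrite !shift => E.
have N0 : (0 < N)%N by apply: leq_ltn_trans (ha ord0).
have E0 : a ord0 = b ord0.
  have := congr1 (modn^~ N) E.
  by rewrite !(addnC (_ ord0)) !modnMDl !modn_small.
have E1 : forall i, a (lift ord0 i) = b (lift ord0 i).
  apply: IH => //.
  by move: E; rewrite E0 => /addnI /eqP; rewrite eqn_pmul2r // => /eqP.
by move=> i; case: (unliftP ord0 i) => [j ->|->].
Qed.

(* Kronecker substitution X_i := x ^ (N ^ i) turns p into a nonzero univariate polynomial *)
Lemma mpoly_nonroot n (p : {mpoly K[n]}) : p != 0 -> exists v, p.@[v] != 0.
Proof.
move=> p0; pose N := msize p; pose code (m : 'X_{1..n}) := (\sum_i m i * N ^ i)%N.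
pose q : {poly K} := \sum_(m <- msupp p) p@_m *: 'X^(code m).
have ltN m i : m \in msupp p -> (m i < N)%N.
  by move=> /msize_mdeg_lt; apply: leq_ltn_trans; rewrite mdegE (bigD1 i) //= leq_addr.
have q0 : q != 0.
  have m0 := mlead_supp p0; apply: contraTneq m0 => q0.
  rewrite mcoeff_msupp negbK; have := congr1 (fun q : {poly K} => q`_(code (mlead p))) q0.
  rewrite coef0 coef_sum (bigD1_seq (mlead p)) ?mlead_supp ?msupp_uniq //= big_seq_cond.
  rewrite big1 => [|m /andP [ms ne]].
    by rewrite addr0 coefZ coefXn eqxx mulr1 => ->.
  rewrite coefZ coefXn; case: eqP => [E|]; rewrite ?mulr0 //.
  by case/eqP: ne; apply/mnmP; apply: (@digits_inj N) => // i; apply: ltN; rewrite ?mlead_supp.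
have [x qx] := poly_nonroot q0; exists (fun i : 'I_n => x ^+ (N ^ i)).
rewrite mevalE; congr (_ != 0): qx; rewrite horner_sum; apply: eq_bigr => m _.
rewrite hornerZ hornerXn; congr (_ * _); rewrite /code expr_sum.
by apply: eq_bigr => i _; rewrite -exprM mulnC.
Qed.

Lemma deriv_eq0_pchar0 (p : {poly K}) : p^`() = 0 -> p = (p`_0)%:P.
Proof.
move=> dp0; apply: size1_polyC; apply/leq_sizeP => -[//|j] _.
have /eqP := congr1 (fun q : {poly K} => q`_j) dp0.
rewrite coef_deriv coef0 -mulr_natr mulf_eq0 (pcharf0P K).1 // orbF.
by move/eqP.
Qed.

(** With p = u q + v the hypothesis becomes u' q^2 = v q' - v' q. The right side has degree below
    that of q^2, so u' = 0. *)
Lemma divp_wronskian_eq0 (p q : {poly K}) : q != 0 -> p^`() * q = p * q^`() ->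
  (p %/ q)^`() = 0.
Proof.
move=> q0; have := ltn_modp p q; have := divp_eq p q.
move: (p %/ q) (p %% q) => u v Ep; rewrite q0 => szv E.
have {}E : u^`() * (q * q) = v * q^`() - v^`() * q.
  apply/eqP; rewrite -subr_eq0; move/eqP: E; rewrite -subr_eq0 => /eqP <-.
  by rewrite Ep derivD derivM; apply/eqP; ring.
apply/eqP; apply: contraTT isT => u0.
have szE := congr1 (fun r : {poly K} => size r) E.
rewrite /= size_mul ?mulf_neq0 // size_mul // in szE.
have q_gt0 : (0 < size q)%N by rewrite size_poly_gt0.
have u_gt0 : (0 < size u^`())%N by rewrite size_poly_gt0.
have dq := lt_size_deriv q0.
have dv : (size v^`() <= size v)%N.
  by have [->|/lt_size_deriv/ltnW //] := eqVneq v 0; rewrite deriv0.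
have lt_pred a b c : (a < b)%N -> (c <= b)%N -> ((a + c).-1 < (b + b).-1)%N by lia.
have lt1 : (size (v * q^`())%R < (size q + size q).-1)%N.
  by apply: leq_ltn_trans (size_polyMleq _ _) _; apply: lt_pred szv (ltnW dq).
have lt2 : (size (- (v^`() * q))%R < (size q + size q).-1)%N.
  rewrite size_polyN; apply: leq_ltn_trans (size_polyMleq _ _) _.
  exact: lt_pred (leq_ltn_trans dv szv) (leqnn _).
have : (size (v * q^`() - v^`() * q)%R < (size q + size q).-1)%N.
  by apply: leq_ltn_trans (size_polyD _ _) _; rewrite gtn_max lt1.
rewrite -szE -(prednK u_gt0) addSn /= ltnNge; case/negP.
exact: leq_addl.
Qed.

(** The quotient of [p] by [q] is a constant c. The remainder v = p - c q again has zero Wronskian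
    with [q]; were it nonzero, the quotient of [q] by v would be constant too, although v has
    smaller degree. *)
Lemma wronskian_eq0 (p q : {poly K}) : q != 0 -> p^`() * q = p * q^`() ->
  exists c, p = c *: q.
Proof.
move=> q0 E; have /deriv_eq0_pchar0 := divp_wronskian_eq0 q0 E.
set c := _`_0 => Ec; exists c; have := divp_eq p q; rewrite Ec mul_polyC.
set v := p %% q => Ep; have [v0|v0] := eqVneq v 0; first by rewrite Ep v0 addr0.
have Ev : q^`() * v = q * v^`().
  have -> : v = p - c *: q by rewrite Ep addrC addKr.
  apply/eqP; rewrite -subr_eq0; move/eqP: E; rewrite eq_sym -subr_eq0 => /eqP <-.
  by rewrite derivB derivZ -!mul_polyC; apply/eqP; ring.
have /deriv_eq0_pchar0 Eq := divp_wronskian_eq0 v0 Ev.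
have contra a b : (0 < b)%N -> (b < a)%N -> (a - b.-1 <= 1)%N -> False by lia.
have szv : (size v < size q)%N by rewrite ltn_modp.
have szv0 : (0 < size v)%N by rewrite size_poly_gt0.
case: (contra _ _ szv0 szv); rewrite -size_divp // Eq.
exact: size_polyC_leq1.
Qed.

(** Induction on [r]: the Wronskians of the other polynomials with the first one are again
    independent, and passing to them lowers an order of vanishing by at most one. [D] collects the
    first polynomials of all stages. *)
Lemma generic_vanishing_order r (p : 'I_r -> {poly K}) :
  (forall c : 'I_r -> K, \sum_i c i *: p i = 0 -> forall i, c i = 0) ->
  exists2 D : {poly K}, D != 0 & forall s, D.[s] != 0 ->
    forall c : 'I_r -> K, ('X - s%:P) ^+ r %| \sum_i c i *: p i -> forall i, c i = 0.
Proof.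
elim: r p => [|r IH] p free_p; first by exists 1; rewrite ?oner_neq0 // => s _ c _ [].
pose q := p ord0; pose w i := (p (lift ord0 i))^`() * q - p (lift ord0 i) * q^`().
have q0 : q != 0.
  apply/eqP => q0; have E1 : \sum_i (i == ord0)%:R *: p i = 0.
    rewrite (bigD1 ord0) //= big1 => [|i /negbTE ->]; last by rewrite scale0r.
    by rewrite -/q q0 scaler0 addr0.
  by have /eqP := free_p _ E1 ord0; rewrite eqxx oner_eq0.
have sum_w (c : 'I_r -> K) (t := \sum_i c i *: p (lift ord0 i)) :
    \sum_i c i *: w i = t^`() * q - t * q^`().
  rewrite /t linear_sum /= !mulr_suml -sumrB; apply: eq_bigr => i _.
  by rewrite /w derivZ -!mul_polyC; ring.
have [|D D0 HD] := IH w.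
  move=> c; rewrite sum_w; set t := \sum_i _ => /eqP; rewrite subr_eq0 => /eqP.
  case/(wronskian_eq0 q0) => a Et i.
  (* The proportionality [t = a *: q] is a linear relation among all the [p i], with coefficient
     [- a] at the first. *)
  pose c' i := if unlift ord0 i is Some j then c j else - a.
  have := free_p c' _ (lift ord0 i); rewrite /c' liftK; apply.
  rewrite big_ord_recl unlift_none -/q scaleNr -Et addrC; apply/eqP; rewrite subr_eq0.
  by apply/eqP/eq_bigr => j _; rewrite liftK.
exists (q * D); first by rewrite mulf_neq0.
move=> s; rewrite hornerM mulf_eq0 negb_or => /andP [qs Ds] c.
rewrite big_ord_recl -/q; set t := \sum_(i < r) _ => dvd.
have c0 : forall i, c (lift ord0 i) = 0.
  apply: (HD s Ds); rewrite sum_w -/t.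
  (* Adding a multiple of [q] does not change the Wronskian with [q], so the order of vanishing of
     the full combination can be used. *)
  have -> : t^`() * q - t * q^`() = (c ord0 *: q + t)^`() * q - (c ord0 *: q + t) * q^`().
    by rewrite derivD derivZ -!mul_polyC; ring.
  case/dvdpP: dvd => h ->; rewrite derivM deriv_exp derivXsubC mul1r /= exprSr.
  by apply/dvdpP; exists ((h^`() * ('X - s%:P) + h *+ r.+1) * q - h * ('X - s%:P) * q^`());
    rewrite -[h *+ _]mulr_natr -mulr_natr; ring.
move=> i; case: (unliftP ord0 i) => [j ->|->]; first exact: c0.
move: dvd; rewrite /t big1 => [|j _]; last by rewrite c0 scale0r.
rewrite addr0 => /(dvdp_trans (dvdp_exp2l _ (ltn0Sn r))); rewrite expr1 dvdp_XsubCl.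
by rewrite rootE hornerZ mulf_eq0 (negbTE qs) orbF => /eqP.
Qed.

End CharacteristicZero.

(** * Three variables: linear changes of coordinates, shears and dehomogenization *)

Local Notation i0 := (@Ordinal 3 0 isT).
Local Notation i1 := (@Ordinal 3 1 isT).
Local Notation i2 := (@Ordinal 3 2 isT).

Lemma ord3P (P : 'I_3 -> Prop) : P i0 -> P i1 -> P i2 -> forall i, P i.
Proof.
by move=> P0 P1 P2 [[|[|[|//]]] lt];
  [rewrite (_ : Ordinal lt = i0)|rewrite (_ : Ordinal lt = i1)|rewrite (_ : Ordinal lt = i2)];
  try exact: val_inj.
Qed.

Lemma sum_ord3 (R : nmodType) (F : 'I_3 -> R) : \sum_i F i = F i0 + F i1 + F i2.
Proof.
rewrite !big_ord_recl big_ord0 addr0 addrA.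
by congr (F _ + F _ + F _); apply: val_inj.
Qed.

Lemma mdeg3 (m : 'X_{1..3}) : mdeg m = (m i0 + m i1 + m i2)%N.
Proof. by rewrite mdegE; exact: sum_ord3. Qed.

Section LinearChange.
Variable K : fieldType.
Local Notation S := {mpoly K[3]}.

HB.instance Definition _ (g : 'M[K]_3) := GRing.RMorphism.copy (lin_change g)
  (comp_mpoly [tuple \sum_(j < 3) g i j *: 'X_j | i < 3]).
HB.instance Definition _ (g : 'M[K]_3) := GRing.Linear.copy (lin_change g)
  (comp_mpoly [tuple \sum_(j < 3) g i j *: 'X_j | i < 3]).

Lemma lin_changeX (g : 'M[K]_3) i : lin_change g 'X_i = \sum_j g i j *: 'X_j.
Proof. by rewrite /lin_change /comp_mpoly mmapX mmap1U tnth_mktuple. Qed.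

Lemma lin_change_mono (g : 'M[K]_3) m :
  lin_change g 'X_[m] = \prod_i (\sum_j g i j *: 'X_j) ^+ m i.
Proof. by rewrite /lin_change comp_mpolyX; apply: eq_bigr => i _; rewrite tnth_mktuple. Qed.

Lemma mpoly_lrmorph_eq (A : lalgType K) (f g : {lrmorphism S -> A}) :
  (forall i, f 'X_i = g 'X_i) -> f =1 g.
Proof.
move=> fg p; rewrite (mpolyE p) !linear_sum; apply: eq_bigr => m _ /=.
rewrite !linearZ /= mpolyXE_id !rmorph_prod; congr (_ *: _); apply: eq_bigr => i _.
by rewrite !rmorphXn /= fg.
Qed.

Lemma lin_changeM (g h : 'M[K]_3) p :
  lin_change g (lin_change h p) = lin_change (h *m g) p.
Proof.
apply: (@mpoly_lrmorph_eq _ (lin_change g \o lin_change h) (lin_change (h *m g))) => i.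
rewrite /= !lin_changeX linear_sum /=.
under eq_bigr do rewrite linearZ /= lin_changeX scaler_sumr.
rewrite exchange_big; apply: eq_bigr => j _ /=.
by rewrite mxE scaler_suml; apply: eq_bigr => k _; rewrite scalerA.
Qed.

Lemma lin_change1 p : lin_change (1%:M : 'M[K]_3) p = p.
Proof.
apply: (@mpoly_lrmorph_eq _ (lin_change 1%:M) idfun) => i.
rewrite /= lin_changeX (bigD1 i) //= mxE eqxx scale1r big1 ?addr0 // => j ne.
by rewrite mxE eq_sym (negbTE ne) scale0r.
Qed.

Lemma lin_change_homog (g : 'M[K]_3) n p : p \is n.-homog -> lin_change g p \is n.-homog.
Proof.
move=> /dhomogP hp; rewrite (mpolyE p) linear_sum /= big_seq.
apply: rpred_sum => m /hp <-; rewrite linearZ /= lin_change_mono; apply: rpredZ.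
have hX i : (\sum_j g i j *: 'X_j : S) \is 1.-homog.
  by apply: rpred_sum => j _; rewrite rpredZ // dhomogX /= mdeg1.
rewrite mdegE; elim/big_rec2: _ => [|i k q _ hq]; first exact: dhomog1.
by apply: dhomogM hq; have := dhomogMn (m i) (hX i); rewrite mul1n.
Qed.

Section Invertible.
Variable g : 'M[K]_3.
Hypothesis Ug : g \in unitmx.

Lemma lin_changeK : cancel (lin_change g) (lin_change (invmx g)).
Proof. by move=> p; rewrite lin_changeM mulmxV // lin_change1. Qed.

Lemma lin_changeVK : cancel (lin_change (invmx g)) (lin_change g).
Proof. by move=> p; rewrite lin_changeM mulVmx // lin_change1. Qed.

Lemma image_idealE (I : S -> Prop) p : image_ideal g I p <-> I (lin_change (invmx g) p).
Proof.
split=> [[q [Iq ->]]|Ip]; first by rewrite lin_changeK.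
by exists (lin_change (invmx g) p); rewrite lin_changeVK.
Qed.
End Invertible.

Lemma linpred_image g (I : S -> Prop) : linpred I -> linpred (image_ideal g I).
Proof.
case=> I0 ID; split=> [|a _ _ [p [Ip ->]] [q [Iq ->]]]; first by exists 0; rewrite linear0.
by exists (a *: p + q); rewrite linearP; split=> //; apply: ID.
Qed.

Lemma image_idealM (g h : 'M[K]_3) (I : S -> Prop) p :
  image_ideal g (image_ideal h I) p <-> image_ideal (h *m g) I p.
Proof.
split=> [[_ [[q [Iq ->]] ->]]|[q [Iq ->]]]; first by exists q; rewrite lin_changeM.
by exists (lin_change h q); rewrite lin_changeM; split=> //; exists q.
Qed.

Lemma dimp_image g (I : S -> Prop) n : g \in unitmx -> linpred I ->
  dimp (image_ideal g I) n = dimp I n.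
Proof.
move=> Ug lI; symmetry; apply: (@dimp_map_eq _ (lin_change g)) => //.
- exact: lin_change_homog.
- by move=> p _ E; rewrite -(lin_changeK Ug p) E linear0.
- exact: linpred_image.
- by move=> p _ Ip; exists p.
- move=> p hp [q [Iq E]]; exists q => //.
  by rewrite -(lin_changeK Ug q) -E; apply: lin_change_homog.
Qed.

Lemma image_ideal_mul g (I : S -> Prop) p q : g \in unitmx ->
  (forall p q, I p -> I (q * p)) -> image_ideal g I p -> image_ideal g I (q * p).
Proof.
move=> Ug IM /(image_idealE Ug) Ip; apply/(image_idealE Ug).
by rewrite rmorphM; apply: IM.
Qed.

(** The substitution x_2 -> x_2 + s x_1. It fixes x_3, so it preserves divisibility by powers of
    x_3. *)
Definition shear (s : K) : 'M[K]_3 := 1%:M + s *: delta_mx i1 i0.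

Lemma shearM s t : shear s *m shear t = shear (s + t).
Proof.
rewrite /shear mulmxDl mul1mx mulmxDr mulmx1 -scalemxAl -scalemxAr mul_delta_mx_0 //.
by rewrite !scaler0 addr0 -addrA -scalerDl [t + s]addrC.
Qed.

Lemma shear0 : shear 0 = 1%:M.
Proof. by rewrite /shear scale0r addr0. Qed.

Lemma shear_unit s : shear s \in unitmx.
Proof.
have : shear s *m shear (- s) = 1%:M by rewrite shearM subrr shear0.
by case/mulmx1_unit.
Qed.

Lemma shear_inv s : invmx (shear s) = shear (- s).
Proof.
have E : shear s *m shear (- s) = 1%:M by rewrite shearM subrr shear0.
by rewrite -[RHS](mulKmx (shear_unit s)) E mulmx1.
Qed.

Lemma lin_change_shearX2 s : lin_change (shear s) 'X_i2 = 'X_i2.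
Proof.
rewrite lin_changeX (bigD1 i2) //= !mxE /= mulr0 addr0 scale1r big1 ?addr0 // => j ne.
by rewrite !mxE /= mulr0 addr0 eq_sym (negbTE ne) scale0r.
Qed.

(** Restriction to x_3 = 0 in the chart x_1 = 1, with x_2 as coordinate. A shear then acts as a
    translation of the variable. *)
Definition dehom (p : S) : {poly K} :=
  mmap (@polyC K) (fun i : 'I_3 => if i == i0 then 1 else if i == i1 then 'X else 0) p.

HB.instance Definition _ := GRing.RMorphism.copy dehom
  (mmap (@polyC K) (fun i : 'I_3 => if i == i0 then 1 else if i == i1 then 'X else 0)).

Fact dehom_is_scalable : scalable dehom.
Proof. by move=> a p; rewrite /dehom mmapZ mul_polyC. Qed.

HB.instance Definition _ := GRing.isScalable.Build K S {poly K} *:%R dehom dehom_is_scalable.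

Lemma dehomX i : dehom 'X_i = if i == i0 then 1 else if i == i1 then 'X else 0.
Proof. by rewrite /dehom mmapX mmap1U. Qed.

Lemma dehom_shear s p : dehom (lin_change (shear s) p) = dehom p \Po ('X + s%:P).
Proof.
pose c : {lrmorphism {poly K} -> {poly K}} := comp_poly ('X + s%:P).
apply: (@mpoly_lrmorph_eq _ (dehom \o lin_change (shear s)) (c \o dehom)).
move=> i; rewrite /= lin_changeX linear_sum /=.
under eq_bigr do rewrite linearZ /= dehomX.
rewrite big_ord_recl !big_ord_recl big_ord0 dehomX /=.
move: i; apply: ord3P => /=; rewrite !mxE /= ?mulr0 ?mulr1 ?addr0 ?add0r ?scale1r ?scale0r.
- by rewrite !addr0 rmorph1.
- by rewrite !addr0 comp_polyX alg_polyC addrC.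
- by rewrite !addr0 comp_poly0.
Qed.

Lemma coef_dehom p b :
  (dehom p)`_b = \sum_(m <- msupp p | (m i1 == b) && (m i2 == 0)%N) p@_m.
Proof.
rewrite /dehom /mmap coef_sum [RHS]big_mkcond; apply: eq_bigr => m _.
rewrite coefCM /mmap1 !big_ord_recl big_ord0 /= expr1n mul1r mulr1.
rewrite (_ : lift ord0 ord0 = i1); last exact: val_inj.
rewrite (_ : lift ord0 (lift ord0 ord0) = i2); last exact: val_inj.
rewrite expr0n; case: (m i2 == 0%N); last by rewrite mulr0 coef0 mulr0 andbF.
by rewrite mulr1 coefXn andbT eq_sym; case: eqP; rewrite ?mulr1 ?mulr0.
Qed.


(** A common form for two kinds of linear conditions: divisibility by a power of x_3, and absence of
    all monomials larger than a given one. *)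
Definition van (D : 'X_{1..3} -> bool) (p : S) := forall m, D m -> p@_m = 0.

Lemma linpred_van D : linpred (van D).
Proof.
split=> [m _|a u v hu hv m Dm]; first by rewrite mcoeff0.
by rewrite mcoeffD mcoeffZ hu ?hv // mulr0 addr0.
Qed.

Definition lowX2 c (m : 'X_{1..3}) := (m i2 < c)%N.

Lemma mcoeffMX2 c (p : S) m : (p * 'X_i2 ^+ c)@_(U_(i2) *+ c + m) = p@_m.
Proof. by rewrite mpolyXn mcoeffMX. Qed.

Lemma van_lowX2P c (p : S) : van (lowX2 c) p <-> multiple ('X_i2 ^+ c) p.
Proof.
split=> [hp|[r ->] m lt].
  exists (\sum_(m <- msupp p) p@_m *: 'X_[m - U_(i2) *+ c]).
  rewrite [LHS]mpolyE mulr_suml !big_seq; apply: eq_bigr => m ms.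
  rewrite -scalerAl mpolyXn -mpolyXD submK //.
  apply/mnm_lepP => i; rewrite mulmnE mnm1E; case: eqP => [<-|]; rewrite ?mul0n // mul1n.
  by rewrite leqNgt; apply: contraTN ms => lt; rewrite mcoeff_msupp hp // eqxx.
apply/eqP; rewrite mpolyXn mcoeff_eq0; apply: contraTN lt => /msuppM_le.
case/allpairsP => -[m1 m2] /= [_]; rewrite msuppX inE => /eqP -> ->.
by rewrite /lowX2 mnmDE mulmnE mnm1E eqxx mul1n -leqNgt leq_addl.
Qed.

(** Monomials of equal degree without x_3 are told apart by their x_2-exponents, so nothing cancels
    in [dehom p]. *)
Lemma dehom_eq0 n p : p \is n.-homog -> dehom p = 0 -> van (lowX2 1) p.
Proof.
move=> /dhomogP hp d0 m; rewrite /lowX2 ltnS leqn0 => m2.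
apply/eqP; case: (boolP (m \in msupp p)) => [ms|]; last by rewrite -mcoeff_eq0.
have := coef_dehom p (m i1).
rewrite d0 coef0 big_mkcond (bigD1_seq m) ?msupp_uniq //= eqxx m2 big_seq_cond.
rewrite big1 ?addr0 => [<- //|m' /andP [m's ne]]; case: ifP => // /andP [/eqP e1 /eqP e2].
case/eqP: ne; have := hp _ m's; have := hp _ ms; rewrite /= !mdeg3 (eqP m2) e1 e2 => <- E.
by apply/mnmP; apply: ord3P; [lia|..]; rewrite ?e1 ?e2 ?(eqP m2).
Qed.

(** The coefficients of the dehomogenized shear are the Taylor coefficients of [dehom p] at [s]. *)
Lemma dehom_dvd r s p :
  (forall b, (b < r)%N -> (dehom (lin_change (shear s) p))`_b = 0) ->
  ('X - s%:P) ^+ r %| dehom p.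
Proof.
rewrite dehom_shear => h; have : 'X^r %| dehom p \Po ('X + s%:P).
  apply/dvdpP; exists (drop_poly r (dehom p \Po ('X + s%:P))).
  rewrite -[LHS](poly_take_drop r) -[RHS]add0r; congr (_ + _).
  apply/polyP => i; rewrite coef_take_poly coef0; case: ifP => // lt; exact: h.
case/dvdpP => w E; apply/dvdpP; exists (w \Po ('X - s%:P)).
have -> : dehom p = (dehom p \Po ('X + s%:P)) \Po ('X - s%:P).
  by rewrite -comp_polyA comp_polyD comp_polyX comp_polyC subrK comp_polyXr.
by rewrite E comp_polyM comp_Xn_poly.
Qed.

End LinearChange.

(** * Openness of dimension bounds in the matrix entries *)

Section Genericity.
Variable K : fieldType.
Local Notation S := {mpoly K[3]}.
Local Notation H := (dhomog 3 K).

Definition mxeval (P : {mpoly K[3 * 3]}) (g : 'M[K]_3) := P.@[fun k => mxvec g 0 k].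

Definition polyfun (F : 'M[K]_3 -> K) := exists P, forall g, mxeval P g = F g.

Lemma polyfunC c : polyfun (fun _ => c).
Proof. by exists c%:MP => g; rewrite /mxeval mevalC. Qed.

Lemma polyfun_entry i j : polyfun (fun g => g i j).
Proof. by exists 'X_(mxvec_index i j) => g; rewrite /mxeval mevalXU mxvecE. Qed.

Lemma polyfunD F G : polyfun F -> polyfun G -> polyfun (fun g => F g + G g).
Proof. by case=> P HP [Q HQ]; exists (P + Q) => g; rewrite /mxeval mevalD -HP -HQ. Qed.

Lemma polyfunM F G : polyfun F -> polyfun G -> polyfun (fun g => F g * G g).
Proof. by case=> P HP [Q HQ]; exists (P * Q) => g; rewrite /mxeval mevalM -HP -HQ. Qed.

Lemma eq_polyfun F G : F =1 G -> polyfun F -> polyfun G.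
Proof. by move=> FG [P HP]; exists P => g; rewrite HP FG. Qed.

Lemma polyfun_sum (I : Type) (r : seq I) (Q : pred I) (F : I -> 'M[K]_3 -> K) :
  (forall i, polyfun (F i)) -> polyfun (fun g => \sum_(i <- r | Q i) F i g).
Proof.
move=> HF; elim: r => [|i r IH].
  by apply: eq_polyfun (polyfunC 0) => g; rewrite big_nil.
case Qi: (Q i); last by apply: eq_polyfun IH => g; rewrite big_cons Qi.
by apply: eq_polyfun (polyfunD (HF i) IH) => g; rewrite big_cons Qi.
Qed.

Definition polymap (F : 'M[K]_3 -> S) := forall m, polyfun (fun g => (F g)@_m).

Lemma polymapM F G : polymap F -> polymap G -> polymap (fun g => F g * G g).
Proof.
move=> HF HG m; apply: eq_polyfun (fun g => esym (mcoeffM _ _ _)) _.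
by apply: polyfun_sum => k; apply: polyfunM.
Qed.

Lemma polymap_prod (I : Type) (r : seq I) (F : I -> 'M[K]_3 -> S) :
  (forall i, polymap (F i)) -> polymap (fun g => \prod_(i <- r) F i g).
Proof.
move=> HF; elim: r => [|i r IH] m.
  by apply: eq_polyfun (polyfunC (1 : S)@_m) => g; rewrite big_nil.
by apply: eq_polyfun (polymapM (HF i) IH m) => g; rewrite big_cons.
Qed.

Lemma polymap_lin_change p : polymap (fun g => lin_change g p).
Proof.
move=> m; have E (g : 'M[K]_3) : \sum_(k <- msupp p) p@_k *
    (\prod_(i < 3) (\sum_j g i j *: 'X_j : S) ^+ k i)@_m = (lin_change g p)@_m.
  rewrite [in RHS](mpolyE p) (linear_sum (lin_change g)) raddf_sum; apply: eq_bigr => k _ /=.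
  by rewrite linearZ /= mcoeffZ lin_change_mono.
apply: eq_polyfun E _; apply: polyfun_sum => k.
apply: polyfunM; first exact: polyfunC.
apply: polymap_prod => i {}m; elim: (k i) m => [|n IH] m.
  by apply: eq_polyfun (polyfunC (1 : S)@_m) => g; rewrite expr0.
have HX : polymap (fun g => \sum_j g i j *: 'X_j).
  move=> m'; have E' (g : 'M[K]_3) :
    \sum_j g i j * ('X_j : S)@_m' = (\sum_j g i j *: 'X_j : S)@_m'.
    by rewrite raddf_sum; apply: eq_bigr => j _ /=; rewrite mcoeffZ.
  apply: eq_polyfun E' _; apply: polyfun_sum => j.
  by apply: polyfunM; [apply: polyfun_entry|apply: polyfunC].
by apply: eq_polyfun (polymapM HX IH m) => g; rewrite exprS.
Qed.

(** A right inverse [B] of [M g0] is kept fixed: the determinant of [M g *m B] is polynomial in [g],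
    equals 1 at [g0], and forces independent rows wherever it is nonzero. *)
Lemma row_free_open k n (M : 'M[K]_3 -> 'M[K]_(k, n)) g0 :
  (forall i j, polyfun (fun g => M g i j)) -> row_free (M g0) ->
  exists2 P, mxeval P g0 != 0 & forall g, mxeval P g != 0 -> row_free (M g).
Proof.
move=> HM /row_freeP [B MB].
have {}HM (ij : 'I_k * 'I_n) : exists P, forall g, mxeval P g = M g ij.1 ij.2 by apply: HM.
have [P HP] := fin_all_exists HM.
pose Q : 'M[{mpoly K[3 * 3]}]_k :=
  \matrix_(i, j) \sum_l P (i, l) * (B l j)%:MP.
have EQ g : mxeval (\det Q) g = \det (M g *m B).
  rewrite /mxeval -det_map_mx; congr (\det _); apply/matrixP => i j.
  rewrite !mxE raddf_sum; apply: eq_bigr => l _ /=.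
  by rewrite mevalM mevalC -/(mxeval _ g) HP.
exists (\det Q) => [|g]; rewrite EQ ?MB ?det1 ?oner_neq0 // => D0.
apply/row_freeP; exists (B *m invmx (M g *m B)).
by rewrite mulmxA mulmxV // unitmxE unitfE.
Qed.

(** Pulling back along [g] keeps the ideal fixed, so that only the vanishing conditions vary with
    [g]. *)
Lemma dimp_image_van g (I : S -> Prop) D t : g \in unitmx -> linpred I ->
  dimp (fun p => image_ideal g I p /\ van D p) t =
  dimp (fun p => I p /\ van D (lin_change g p)) t.
Proof.
move=> Ug lI; symmetry; apply: (@dimp_map_eq _ (lin_change g)) => //.
- exact: lin_change_homog.
- by move=> p _ E; rewrite -(lin_changeK Ug p) E linear0.
- exact/(linpredI lI)/(linpred_comp (lin_change _))/linpred_van.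
- exact/linpredI/linpred_van/linpred_image.
- by move=> p _ [Ip Dp]; split=> //; exists p.
- move=> p hp [[q [Iq E]] Dp]; exists q; last by rewrite -E.
  by rewrite -(lin_changeK Ug q) -E; apply: lin_change_homog.
Qed.

(** Semicontinuity of kernel dimensions. On a complement [U] of the solution space at [g0] the
    conditions are injective, which is an open property; where it persists, the solution space meets
    [U] only in zero and cannot be larger than at [g0]. *)
Lemma dimp_image_van_open (I : S -> Prop) D t e g0 : linpred I -> g0 \in unitmx ->
  (dimp (fun p => image_ideal g0 I p /\ van D p) t <= e)%N ->
  exists2 P, P != 0 & forall g, g \in unitmx -> mxeval P g != 0 ->
    (dimp (fun p => image_ideal g I p /\ van D p) t <= e)%N.
Proof.
move=> lI Ug0; rewrite dimp_image_van // => le_e.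
pose V g (p : S) := I p /\ van D (lin_change g p).
have lV g : linpred (V g).
  exact/(linpredI lI)/(linpred_comp (lin_change _))/linpred_van.
pose U := (gp I t :\: gp (V g0) t)%VS; pose u := vbasis U.
pose comb (c : 'rV[K]_(\dim U)) : H t := \sum_i c 0 i *: u`_i.
have combU c : comb c \in U.
  by apply: rpred_sum => i _; apply/rpredZ/vbasis_mem/mem_nth; rewrite size_tuple.
(* The columns of [M] run over the finitely many monomials of degree at most [t]; those outside [D]
   give zero columns. *)
pose T := 'X_{1..3 < t.+1}.
pose M g := \matrix_(i < \dim U, j < #|{: T}|)
  if D (enum_val j : T) then (lin_change g (val u`_i))@_(enum_val j : T) else 0.
have MV g c : c *m M g = 0 <-> comb c \in gp (V g) t.
  have E m : \sum_i c 0 i * (lin_change g (val u`_i))@_m = (lin_change g (val (comb c)))@_m.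
    have -> : val (comb c) = \sum_i c 0 i *: val u`_i.
      exact: (raddf_sum (@mpoly_of_dhomog 3 K t)).
    rewrite (linear_sum (lin_change g)) raddf_sum; apply: eq_bigr => i _ /=.
    by rewrite linearZ /= mcoeffZ.
  split=> [cM|/gpP-/(_ (lV g)) [_ Dc]].
    apply/gpP => //; split.
      by apply/(proj1 (gpP _ lI)); apply: (subvP (diffvSl _ (gp (V g0) t))).
    move=> m Dm; have [/eqP tm|ne] := boolP (mdeg m == t); last first.
      have := lin_change_homog g (dhomog_is_dhomog (comb c)).
      by move/(dhomog_nemf_coeff)/(_ ne).
    have lt : (mdeg m < t.+1)%N by rewrite tm.
    have := congr1 (fun A : 'rV_#|{: T}| => A 0 (enum_rank (BMultinom lt))) cM.
    rewrite !mxE -E => {}cM; rewrite -[RHS]cM; apply: eq_bigr => i _.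
    by rewrite mxE enum_rankK Dm.
  apply/rowP => j; rewrite !mxE; case Dj: (D (enum_val j : T)); last first.
    by rewrite big1 // => i _; rewrite mxE Dj mulr0.
  rewrite -[RHS](Dc _ Dj) -E; apply: eq_bigr => i _.
  by rewrite mxE Dj.
have HM i j : polyfun (fun g => M g i j).
  case Dj: (D (enum_val j : T)).
    by apply: eq_polyfun (polymap_lin_change (val u`_i) (enum_val j : T)) => g; rewrite mxE Dj.
  by apply: eq_polyfun (polyfunC 0) => g; rewrite mxE Dj.
have comb0 c : comb c = 0 -> c = 0.
  move=> E; apply/rowP => i; rewrite mxE.
  by have /freeP := basis_free (vbasisP U); move/(_ _ E i).
have rf0 : row_free (M g0).
  apply: inj_row_free => c /MV cV; apply: comb0; apply/eqP.
  rewrite -memv0 -(capv_diff (gp I t) (gp (V g0) t)).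
  by apply/memv_capP.
have [P P0 HP] := row_free_open HM rf0; exists P.
  by apply: contraNneq P0 => ->; rewrite /mxeval meval0.
move=> g Ug /HP rf; rewrite dimp_image_van //; apply: leq_trans le_e.
have sV h : (gp (V h) t <= gp I t)%VS.
  by apply/subvP => v /gpP-/(_ (lV h)) [Iv _]; apply/gpP.
have UV0 : (U :&: gp (V g) t = 0)%VS.
  apply/eqP; rewrite -subv0; apply/subvP => v /memv_capP [Uv].
  have Ev : v = comb (\row_i coord u i v).
    by rewrite [LHS](coord_vbasis Uv); apply: eq_bigr => i _; rewrite mxE.
  rewrite Ev => /MV => E0; suff -> : \row_i coord u i v = 0.
    by rewrite memv0; apply/eqP; apply: big1 => i _; rewrite mxE scale0r.
  by apply: (row_free_inj rf); rewrite E0 mul0mx.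
have := dimv_sum_cap U (gp (V g) t); rewrite UV0 dimv0 addn0.
have : (\dim (U + gp (V g) t) <= \dim (gp I t))%N.
  by apply: dimvS; rewrite subv_add sV diffvSl.
have := dimv_cap_compl (gp I t) (gp (V g0) t); rewrite (capv_idPr (sV g0)).
rewrite -/U /dimp -/(V g) -/(V g0); lia.
Qed.

End Genericity.

(** * The reverse lexicographic order, and initial ideals read off from dimensions *)

Section Revlex.
Variable K : fieldType.
Local Notation S := {mpoly K[3]}.
Local Notation H := (dhomog 3 K).

Lemma revlex_gtE a b : revlex_gt a b =
  (a i2 < b i2)%N || ((a i2 == b i2) && ((a i1 < b i1)%N || ((a i1 == b i1) && (a i0 < b i0)%N))).
Proof.
have fa (P : pred 'I_3) : [forall i, P i] = [&& P i0, P i1 & P i2].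
  apply/forallP/and3P => [h|[? ? ?]]; [by split|exact: ord3P].
have ex (P : pred 'I_3) : [exists i, P i] = [|| P i0, P i1 | P i2].
  by rewrite -[LHS]negbK negb_exists fa !negb_and !negbK.
rewrite /revlex_gt ex !fa /=; lia.
Qed.

(** Within one degree, these are the monomials larger than the one with x_3-exponent [c] and
    x_2-exponent [j]. *)
Definition lowX12 c j (m : 'X_{1..3}) :=
  (m i2 < c)%N || ((m i2 == c) && (m i1 < j)%N).

Lemma mnm3_eq (a b : 'X_{1..3}) : mdeg a = mdeg b -> a i1 = b i1 -> a i2 = b i2 -> a = b.
Proof. by rewrite !mdeg3 => e e1 e2; apply/mnmP; apply: ord3P; lia. Qed.

Lemma homog_mdeg t (p : S) m : p \is t.-homog -> p@_m != 0 -> mdeg m = t.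
Proof. by move=> /dhomogP hp; rewrite -mcoeff_msupp; apply: hp. Qed.

Lemma is_lead_mono_van t (p : S) m : p \is t.-homog -> mdeg m = t ->
  is_lead_mono p m <-> p@_m != 0 /\ van (lowX12 (m i2) (m i1)) p.
Proof.
move=> hp tm; split=> [[pm lead]|[pm vp]]; split=> // m'.
  move=> low; apply/eqP; apply: contraTT low => pm'.
  have [-> //|ne] := eqVneq m' m; first by rewrite /lowX12; lia.
  by have := lead _ pm' ne; rewrite revlex_gtE /lowX12; lia.
move=> pm' ne.
have tm' := homog_mdeg hp pm'.
have : ~~ lowX12 (m i2) (m i1) m' by apply: contra pm' => /vp ->.
have : (m' i1 == m i1) && (m' i2 == m i2) = false.
  by apply: contraNF ne => /andP [/eqP e1 /eqP e2]; apply/eqP/mnm3_eq; rewrite ?tm.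
rewrite revlex_gtE /lowX12; lia.
Qed.

(** In degree [t] at most one monomial separates the two sets of conditions, so at most one linear
    condition is added. *)
Lemma dimp_van_lowX12S (V : S -> Prop) c j t : linpred V ->
  (dimp (fun p => V p /\ van (lowX12 c j) p) t <=
   (dimp (fun p => V p /\ van (lowX12 c j.+1) p) t).+1)%N.
Proof.
move=> lV; set P := fun p => _; set Q := fun p => _.
have lP : linpred P by apply/linpredI/linpred_van.
have lQ : linpred Q by apply/linpredI/linpred_van.
case: (classic (forall p, p \is t.-homog -> P p -> Q p)) => [PQ|nPQ].
  exact/leqW/dimp_le.
have [u nu] := not_all_ex_not _ _ nPQ.
have [hu {}nu] := imply_to_and _ _ nu; have [[Vu Pu] nQu] := imply_to_and _ _ nu.
have [m Dm um] : exists2 m, lowX12 c j.+1 m & u@_m != 0.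
  apply: NNPP => nm; apply: nQu; split=> // m Dm; apply/eqP; rewrite -[_ == _]negbK.
  by apply/negP => um; apply: nm; exists m.
have tm := homog_mdeg hu um.
have nDm : ~~ lowX12 c j m by apply: contra um => /Pu ->.
apply: (@leq_trans (\dim (gp Q t + <[DHomog hu]>)%VS)).
  apply/dimvS/subvP => v /gpP-/(_ lP) [Vv Pv].
  pose w := v - ((val v)@_m / u@_m) *: DHomog hu.
  have -> : v = w + ((val v)@_m / u@_m) *: DHomog hu by rewrite subrK.
  apply: memv_add; last by rewrite memvZ ?memv_line.
  apply/gpP => //; split; first by apply: linpredB => //; apply: linpredZ.
  move=> m' Dm' /=; rewrite mcoeffB mcoeffZ.
  have [Dm''|nDm'] := boolP (lowX12 c j m'); first by rewrite (Pv _ Dm'') (Pu _ Dm'') mulr0 subr0.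
  have [/eqP tm'|ne] := boolP (mdeg m' == t); last first.
    by rewrite !(dhomog_nemf_coeff _ ne) ?mulr0 ?subr0 // dhomog_is_dhomog.
  have -> : m' = m.
    apply: mnm3_eq; rewrite ?tm //; move: Dm Dm' nDm nDm'; rewrite /lowX12; lia.
  by rewrite divfK // subrr.
have := (dimv_add_leqif (gp Q t) <[DHomog hu]>%VS).1; rewrite dim_vline.
by move/leq_trans; apply; rewrite /dimp -[leqRHS]addn1 leq_add2l; case: eqP.
Qed.

Lemma dimp_van_lowX12D (V : S -> Prop) c j k t : linpred V ->
  (dimp (fun p => V p /\ van (lowX12 c j) p) t <=
   dimp (fun p => V p /\ van (lowX12 c (j + k)) p) t + k)%N.
Proof.
move=> lV; elim: k => [|k IH]; first by rewrite !addn0.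
apply: leq_trans IH _; rewrite [(j + k.+1)%N]addnS -[leqRHS]addSnnS leq_add2r.
exact: dimp_van_lowX12S.
Qed.

Lemma dimp_van_lowX12_0 (V : S -> Prop) c t : linpred V ->
  dimp (fun p => V p /\ van (lowX12 c 0) p) t = dimp (fun p => V p /\ van (lowX2 c) p) t.
Proof.
move=> lV; apply: dimp_eq => [||p _]; try exact/linpredI/linpred_van.
split=> -[Vp vp]; split=> // m lt; apply: vp; move: lt; rewrite /lowX12 /lowX2.
  by move->.
by rewrite andbF orbF.
Qed.

(* Both hypotheses are then equalities: every element of [V_t] divisible by [x_3^c] and free of
   the [r c] largest monomials of [x_3]-degree [c] is divisible by [x_3^(c+1)]. *)
Lemma initial_idealE (V : S -> Prop) t (e : nat -> nat) (r := fun c => (e c - e c.+1)%N) :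
  linpred V -> (forall c, e c <= dimp (fun p => V p /\ van (lowX2 c) p) t)%N ->
  (forall c, c <= t -> dimp (fun p => V p /\ van (lowX12 c (r c)) p) t <= e c.+1)%N ->
  forall m, mdeg m = t -> initial_ideal V m <-> (m i1 < r (m i2))%N.
Proof.
move=> lV lo hi m tm; set c := m i2; set b := m i1.
have ct : (c <= t)%N by rewrite -tm mdeg3; lia.
have lvan D : linpred (fun p => V p /\ van D p) by apply/linpredI/linpred_van.
split=> [[p [Vp [[t' hp] [p0 lead]]]]|lt].
  have tt' : t' = t by rewrite -tm (homog_mdeg hp lead.1).
  rewrite tt' in hp; case/(is_lead_mono_van hp tm): lead => pm vp.
  rewrite ltnNge; apply/negP => le; case/eqP: pm.
  have : V p /\ van (lowX2 c.+1) p.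
    apply: (dimp_le_sub (lvan _) (lvan (lowX12 c (r c))) _ _ hp).
    - move=> q _ [Vq vq]; split=> // m' low; apply: vq; move: low.
      by rewrite /lowX12 /lowX2; lia.
    - by apply: leq_trans (hi c ct) (lo _).
    - split=> // m' low; apply: vp; move: low le; rewrite /lowX12 -/c -/b; lia.
  by case=> _; apply; rewrite /lowX2.
have [p [hp Vp vp pm]] : exists p, [/\ p \is t.-homog, V p, van (lowX12 c b) p & p@_m != 0].
  (* Otherwise the step from [b] to [b.+1] costs no dimension, and the remaining [r c - 1] steps
     cannot account for the drop from [e c] to [e c.+1]. *)
  apply: NNPP => np.
  have : (dimp (fun p => V p /\ van (lowX12 c b) p) t <=
          dimp (fun p => V p /\ van (lowX12 c b.+1) p) t)%N.
    apply: dimp_le => // p hp [Vp vp]; split=> // m' low.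
    have [/vp //|nlow] := boolP (lowX12 c b m').
    have [/eqP tm'|ne] := boolP (mdeg m' == t); last exact: dhomog_nemf_coeff hp ne.
    have -> : m' = m.
      by apply: mnm3_eq; rewrite ?tm //; move: low nlow; rewrite /lowX12 -/c -/b; lia.
    apply/eqP; rewrite -[_ == _]negbK; apply/negP => pm; apply: np.
    by exists p.
  have := dimp_van_lowX12D c 0 b t lV; rewrite add0n dimp_van_lowX12_0 //.
  have := dimp_van_lowX12D c b.+1 (r c - b.+1) t lV; rewrite subnKC //.
  have := lo c; have := hi c ct; move: lt; rewrite /r; lia.
exists p; split=> //; split; first by exists t.
split; first by apply: contraNneq pm => ->; rewrite mcoeff0.
exact/(is_lead_mono_van hp tm).
Qed.

End Revlex.

(** * General shears and the largest monomials of a given x_3-degree *)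

Section Shear.
Variable K : fieldType.
Hypothesis K0 : [pchar K] =i pred0.
Local Notation S := {mpoly K[3]}.
Local Notation H := (dhomog 3 K).

Lemma X2_homog c : ('X_i2 ^+ c : S) \is c.-homog.
Proof.
have : ('X_i2 : S) \is 1.-homog by rewrite dhomogX /= mdeg1.
by move/(dhomogMn c); rewrite mul1n.
Qed.

Lemma X2_neq0 c : ('X_i2 ^+ c : S) != 0.
Proof. by rewrite mpolyXn -msize_poly_eq0 msizeX. Qed.

Lemma dimp_X2_colon (V : S -> Prop) c n : linpred V ->
  dimp (fun q => V (q * 'X_i2 ^+ c)) n = dimp (fun p => V p /\ van (lowX2 c) p) (n + c).
Proof.
move=> lV; rewrite (dimp_colon n (X2_neq0 c) (X2_homog c) lV).
apply: dimp_eq => [||p _]; try exact/linpredI/linpred_van; try exact/linpredI/linpred_multiple.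
by split=> -[Vp h]; split=> //; apply/van_lowX2P.
Qed.

Lemma van_lowX2M c d (q : S) : van (lowX2 (d + c)) (q * 'X_i2 ^+ c) <-> van (lowX2 d) q.
Proof.
split=> [h m lt|/van_lowX2P [r ->]].
  rewrite -(mcoeffMX2 c) h // /lowX2 mnmDE mulmnE mnm1E eqxx mul1n addnC.
  by rewrite ltn_add2r.
by apply/van_lowX2P; exists r; rewrite exprD mulrA.
Qed.

(** Dividing by x_3^c and dehomogenizing turns the quotient of the two spaces in the hypothesis into
    univariate polynomials of dimension at most [r]. If a sheared element lacks the [r] largest
    monomials, its polynomial vanishes to order [r] at [s], hence is zero for general [s]. *)
Lemma shear_witness (V : S -> Prop) n c r : linpred V ->
  (dimp (fun p => V p /\ van (lowX2 c) p) (n + c) <=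
   dimp (fun p => V p /\ van (lowX2 c.+1) p) (n + c) + r)%N ->
  exists s, (dimp (fun p => image_ideal (shear s) V p /\ van (lowX12 c r) p) (n + c) <=
             dimp (fun p => V p /\ van (lowX2 c.+1) p) (n + c))%N.
Proof.
move=> lV; set P := fun p => V p /\ van (lowX2 c.+1) p.
have lP : linpred P by apply/linpredI/linpred_van.
have EP : dimp P (n + c) = dimp (fun q => P (q * 'X_i2 ^+ c)) n.
  rewrite dimp_X2_colon //; apply: dimp_eq => [||p _] //; first exact/linpredI/linpred_van.
  split=> [Pp|[]//]; split=> // m lt; apply: Pp.2; exact: ltnW.
rewrite EP -dimp_X2_colon // -EP.
pose VX q := V (q * 'X_i2 ^+ c); pose PX q := P (q * 'X_i2 ^+ c).
have lVX : linpred VX by apply: linpred_colon.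
have lPX : linpred PX by apply: linpred_colon.
rewrite EP -/VX -/PX /dimp; set W := gp VX n; set W0 := gp PX n => le.
have sW : (W0 <= W)%VS by apply/subvP => v /gpP-/(_ lPX) [Vv _]; apply/gpP.
have dimC := dimv_cap_compl W W0; rewrite (capv_idPr sW) in dimC.
(* [W0] is the kernel of [dehom] on [W], so [dehom] is injective on the complement [C]. *)
pose C := (W :\: W0)%VS; pose w := vbasis C.
have memW0 v : v \in W -> dehom (val v) = 0 -> v \in W0.
  move=> /gpP-/(_ lVX) Vv d0; apply/gpP => //; split=> //.
  by rewrite -(add1n c); apply/van_lowX2M/(dehom_eq0 _ d0)/dhomog_is_dhomog.
have dehomW0 v : v \in W0 -> dehom (val v) = 0.
  move=> /gpP-/(_ lPX) [_]; rewrite -(add1n c) => /van_lowX2M vv.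
  apply/polyP => b; rewrite coef_dehom coef0; apply: big1_seq => m /andP [/andP [_ m2] _].
  by apply: vv; rewrite /lowX2 (eqP m2).
have valC (a : 'I_(\dim C) -> K) :
    dehom (val (\sum_i a i *: w`_i)) = \sum_i a i *: dehom (val w`_i).
  rewrite [val _](raddf_sum (@mpoly_of_dhomog 3 K n)) (linear_sum (@dehom K)).
  by apply: eq_bigr => i _ /=; rewrite linearZ.
have C0 v : v \in C -> dehom (val v) = 0 -> v = 0.
  move=> Cv d0; apply/eqP; rewrite -memv0 -(capv_diff W W0); apply/memv_capP; split=> //.
  by apply: memW0 d0; apply: (subvP (diffvSl W W0)).
have [|D D0 HD] := @generic_vanishing_order _ K0 _ (fun i : 'I_(\dim C) => dehom (val w`_i)).
  move=> a; rewrite -valC => d0; have /freeP := basis_free (vbasisP C); apply.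
  apply: C0 d0; apply: rpred_sum => i _; apply/rpredZ/vbasis_mem/mem_nth.
  by rewrite size_tuple.
have [s Ds] := poly_nonroot K0 D0; exists s.
rewrite -/(dimp _ _) dimp_image_van ?shear_unit // -/(dimp PX n) -EP.
apply: dimp_le => //.
  exact/(linpredI lV)/(linpred_comp (lin_change _))/linpred_van.
move=> p hp [Vp vp]; split=> //.
have [q' Eq'] : multiple ('X_i2 ^+ c) (lin_change (shear s) p).
  by apply/van_lowX2P => m lt; apply: vp; rewrite /lowX12; move: lt; rewrite /lowX2 => ->.
pose q := lin_change (invmx (shear s)) q'.
have Ep : p = q * 'X_i2 ^+ c.
  rewrite -[LHS](lin_changeK (shear_unit s)) Eq' rmorphM rmorphXn /=.
  by congr (_ * _ ^+ _); rewrite shear_inv lin_change_shearX2.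
have hq : q \is n.-homog by apply: (homog_div (X2_neq0 c) (X2_homog c)); rewrite -Ep.
have Wq : DHomog hq \in W by apply/gpP; rewrite // /VX /= -Ep.
have := Wq; rewrite -{1}(addv_diff_cap W W0).
case/memv_addP => x Cx [y /memv_capP [_ W0y] Exy].
have Edq : dehom q = dehom (val x).
  have -> : q = val x + val y by rewrite -[q]/(val (DHomog hq)) Exy.
  by rewrite (raddfD (@dehom K)) /= (dehomW0 y W0y) addr0.
have dvd : ('X - s%:P) ^+ r %| dehom q.
  apply: dehom_dvd => b br; rewrite lin_changeVK ?shear_unit //.
  rewrite coef_dehom; apply: big1_seq => m /andP [/andP [m1 m2] _].
  rewrite -(mcoeffMX2 c) -Eq'; apply: vp.
  by rewrite /lowX12 !mnmDE !mulmnE !mnm1E /= (eqP m1) (eqP m2); lia.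
have Ex := coord_vbasis Cx.
have x0 : x = 0.
  rewrite Ex; apply: big1 => i _; rewrite (HD s Ds (fun i => coord w i x)) ?scale0r //.
  (* Vanishing to order [r] is enough because [C] has dimension at most [r]. *)
  rewrite -valC -Ex -Edq; apply: dvdp_trans dvd; apply: dvdp_exp2l.
  by rewrite -(leq_add2l (\dim W0)) dimC.
rewrite x0 add0r in Exy; have /gpP-/(_ lPX) [_] : DHomog hq \in W0 by rewrite Exy.
by rewrite /= -Ep.
Qed.

End Shear.

(** * Consequences of the strong Lefschetz property *)

Section Lefschetz.
Variable K : fieldType.
Local Notation S := {mpoly K[3]}.

(** The rank factorization sends [l] to a multiple of the first unit row, and a transposition moves
    that to the last. It is used to turn a Lefschetz form into a multiple of x_3. *)
Lemma row_to_delta (l : 'rV[K]_3) : l != 0 ->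
  exists2 g, g \in unitmx & exists2 a, a != 0 & l *m g = a *: delta_mx 0 i2.
Proof.
move=> l0; exists (invmx (row_ebase l) *m tperm_mx i0 i2).
  by rewrite unitmx_mul unitmx_inv row_ebase_unit unitmx_perm.
have rl : \rank l = 1%N by rewrite rank_rV l0.
have El := mulmx_ebase l; rewrite rl in El.
exists (col_ebase l 0 0); first by have := col_ebase_unit l; rewrite unitmxE unitfE det_mx11.
rewrite -[X in X *m _]El mulmxA mulmxK ?row_ebase_unit //.
rewrite [X in X *m _ *m _]mx11_scalar mul_scalar_mx -scalemxAl; congr (_ *: _).
have -> : pid_mx 1 = delta_mx 0 i0 :> 'rV[K]_3.
  by apply/rowP; apply: ord3P; rewrite !mxE.
by rewrite -rowE; apply/rowP => j; rewrite !mxE tpermL eqxx /= [j == _]eq_sym.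
Qed.

Lemma homog1E (l : S) : l \is 1.-homog -> l = \sum_i l@_U_(i) *: 'X_i.
Proof.
move=> hl; apply/mpolyP => m; rewrite raddf_sum /=.
have [/eqP m1|ne] := boolP (mdeg m == 1%N); last first.
  rewrite (dhomog_nemf_coeff hl ne) big1 // => i _; rewrite mcoeffZ mcoeffX.
  by case: (U_(i)%MM =P m) ne => [<-|]; rewrite ?mulr0 // mdeg1.
have /mdeg1P [i /eqP ->] : mdeg m == 1%N by apply/eqP.
rewrite (bigD1 i) //= mcoeffZ mcoeffXU eqxx mulr1 big1 ?addr0 // => j ne.
by rewrite mcoeffZ mcoeffXU (negbTE ne) mulr0.
Qed.

Lemma lin_change_to_X2 (l : S) : l \is 1.-homog -> l != 0 ->
  exists2 g, g \in unitmx & exists2 a, a != 0 & lin_change g l = a *: 'X_i2.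
Proof.
move=> hl l0; pose v : 'rV[K]_3 := \row_i l@_U_(i).
have [|g Ug [a a0 E]] := @row_to_delta v.
  apply: contraNneq l0 => v0; rewrite (homog1E hl); apply/eqP; apply: big1 => i _.
  by have := congr1 (fun A : 'rV_3 => A 0 i) v0; rewrite !mxE => ->; rewrite scale0r.
exists g => //; exists a => //; rewrite (homog1E hl) (linear_sum (lin_change g)) /=.
under eq_bigr do rewrite linearZ /= lin_changeX scaler_sumr.
rewrite exchange_big /= (bigD1 i2) //= [X in _ + X]big1 => [|j ne].
  rewrite addr0; under eq_bigr do rewrite scalerA.
  rewrite -scaler_suml; congr (_ *: _).
  have := congr1 (fun A : 'rV_3 => A 0 i2) E; rewrite !mxE eqxx mulr1 => <-.
  by apply: eq_bigr => i _; rewrite mxE.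
under eq_bigr do rewrite scalerA.
rewrite -scaler_suml.
have := congr1 (fun A : 'rV_3 => A 0 j) E; rewrite !mxE (negbTE ne) andbF mulr0 => E0.
by rewrite -[X in X *: _](_ : 0 = _) ?scale0r // -[LHS]E0; apply: eq_bigr => i _; rewrite mxE.
Qed.

Section Ideal.
Variable I : S -> Prop.
Hypotheses (lI : linpred I) (IM : forall p q, I p -> I (q * p)).
Local Notation h := (hilb I).

(** A monomial of the next degree is a variable times one already reached modulo [I]; the preimage
    is multiplied by that variable. *)
Lemma mult_surjectiveS l t : l \is 1.-homog ->
  mult_surjective I l 1 t -> mult_surjective I l 1 t.+1.
Proof.
move=> hl sur p hp.
pose Q (p : S) := exists g : S, g \is t.+1.-homog /\ I (p - g * l ^+ 1).
have lQ : linpred Q.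
  split=> [|a u v [g [hg Ig]] [g' [hg' Ig']]].
    by exists 0; rewrite rpred0 mul0r subr0; split=> //; case: lI.
  exists (a *: g + g'); split; first by apply: rpredD => //; apply: rpredZ.
  have -> : a *: u + v - (a *: g + g') * l ^+ 1 = a *: (u - g * l ^+ 1) + (v - g' * l ^+ 1).
    by rewrite mulrDl -scalerAl scalerBr; ring.
  by case: lI => _; apply.
rewrite (mpolyE p); rewrite big_seq.
apply: (@linpred_sum _ Q) => // m ms; apply: linpredZ => //.
have tm : mdeg m = (t.+1 + 1)%N by apply: (homog_mdeg hp); rewrite -mcoeff_msupp.
have [i mi] : exists i, m i != 0%N.
  apply/existsP; rewrite -[[exists _, _]]negbK negb_exists; apply/negP => /forallP m0.
  move: tm; rewrite mdegE big1 ?addn1 // => i _.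
  by apply/eqP; have := m0 i; rewrite negbK.
have Em : (m - U_(i) + U_(i))%MM = m by rewrite submK // lep1mP.
have hm : 'X_[K, m - U_(i)] \is (t + 1).-homog.
  by rewrite dhomogX /=; apply/eqP; move: tm; rewrite -[in mdeg m]Em mdegD mdeg1; lia.
have [g [hg Ig]] := sur _ hm; exists ('X_i * g); split.
  rewrite -[t.+1]add1n; apply: dhomogM => //; first by rewrite dhomogX /= mdeg1.
by rewrite -Em mpolyXD -mulrA [X in X - _]mulrC -mulrBr; apply: IM.
Qed.

(** Injectivity says that in degree [t] the colon ideal of [I] by [l ^+ b] is [I]. *)
Lemma dimp_mult_injective l b t : l \is 1.-homog -> l != 0 ->
  mult_injective I l b t -> dimp (fun p => I p /\ multiple (l ^+ b) p) (t + b) = dimp I t.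
Proof.
move=> hl l0 inj; have hlb : l ^+ b \is b.-homog.
  by have := dhomogMn b hl; rewrite mul1n.
rewrite -(dimp_colon t (expf_neq0 b l0) hlb lI); apply: dimp_eq => //.
  exact: linpred_colon.
by move=> p hp; split=> [|Ip]; [apply: inj|rewrite mulrC; apply: IM].
Qed.

(** Surjectivity says that [I] and the multiples of [l ^+ b] together span degree [t + b]. *)
Lemma hilb_mult_surjective l b t : l \is 1.-homog -> l != 0 -> mult_surjective I l b t ->
  (dimp (fun p => I p /\ multiple (l ^+ b) p) (t + b) + h (t + b) <= dimS K t)%N.
Proof.
move=> hl l0 sur; have hlb : l ^+ b \is b.-homog.
  by have := dhomogMn b hl; rewrite mul1n.
have lM := linpred_multiple (l ^+ b).
have full : (gp I (t + b) + gp (multiple (l ^+ b)) (t + b))%VS = fullv.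
  apply/vspaceP => v; rewrite memvf; apply/memv_addP.
  have [g [hg Ig]] := sur _ (dhomog_is_dhomog v).
  have hgl : g * l ^+ b \is (t + b).-homog by apply: dhomogM.
  exists (v - DHomog hgl); first exact/gpP.
  by exists (DHomog hgl); [apply/gpP => //; exists g | rewrite subrK].
have := dimv_sum_cap (gp I (t + b)) (gp (multiple (l ^+ b)) (t + b)).
rewrite full -/(dimS K (t + b)) -gpI // -!/(dimp _ _) (dimp_multiple t (expf_neq0 b l0) hlb).
have := dimp_hilb I (t + b); lia.
Qed.

Lemma hilb_eq0 n : (forall p, p \is n.-homog -> I p) -> h n = 0%N.
Proof.
move=> In; rewrite /hilb (@dimp_eq _ I (fun _ => True)) ?dimpT ?subnn // => p hp.
by split=> // _; apply: In.
Qed.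

Hypothesis SLP : strong_Lefschetz I.

(* If [l = 0] then one of [A_n], [A_(n + c)] vanishes for every [c > 0],
   and the identity will do. *)
Lemma lefschetz_change : exists2 g, g \in unitmx & forall n c,
  (dimp (fun p => image_ideal g I p /\ van (lowX2 c) p) (n + c) <=
   dimS K n - minn (h n) (h (n + c)))%N.
Proof.
have [l [hl sl]] := SLP.
have [l0|l0] := eqVneq l 0.
  exists 1%:M => [|n c]; first exact: unitmx1.
  have lV := linpred_image 1%:M lI.
  case: c => [|c].
    rewrite addn0 minnn -(dimp_hilb I n) addnK -(dimp_image n (unitmx1 _ _) lI).
    apply: dimp_le => // [|p _ []//]; exact/linpredI/linpred_van.
  apply: (@leq_trans (dimS K n)).
    rewrite -(dimp_multiple n (X2_neq0 K c.+1) (X2_homog K c.+1)).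
    apply: dimp_le => [||p _ [_ /van_lowX2P //]]; first exact/linpredI/linpred_van.
    exact: linpred_multiple.
  suff [-> | ->] : h n = 0%N \/ h (n + c.+1) = 0%N by rewrite ?min0n ?minn0 subn0.
  case: (sl c.+1 n (ltn0Sn c)) => [inj|sur]; [left|right]; apply: hilb_eq0 => p hp.
    by apply: inj => //; rewrite l0 expr0n mulr0; case: lI.
  by have [g [_]] := sur p hp; rewrite l0 expr0n mulr0 subr0.
have [g Ug [a a0 Egl]] := lin_change_to_X2 hl l0; exists g => // n c.
rewrite dimp_image_van //.
(* [g] carries [l] to [a *: 'X_i2], so divisibility by x_3^c pulls back to divisibility by
   [l ^+ c]. *)
apply: (@leq_trans (dimp (fun p => I p /\ multiple (l ^+ c) p) (n + c))).
  apply: dimp_le.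
  - exact/(linpredI lI)/(linpred_comp (lin_change _))/linpred_van.
  - exact/linpredI/linpred_multiple.
  move=> p hp [Ip /van_lowX2P [r Er]]; split=> //.
  exists (a ^- c *: lin_change (invmx g) r).
  apply: (can_inj (lin_changeK Ug)); rewrite Er rmorphM rmorphXn /= linearZ /= lin_changeVK // Egl.
  by rewrite exprZn -scalerAr -scalerAl scalerA mulfV ?scale1r // expf_neq0.
have [c0|c0] := posnP c.
  rewrite c0 addn0 minnn -(dimp_hilb I n) addnK.
  apply: dimp_le => // [|p _ []//]; exact/linpredI/linpred_multiple.
have [inj|sur] := sl c n c0.
  rewrite dimp_mult_injective //; have := dimp_hilb I n; lia.
have := hilb_mult_surjective hl l0 sur; lia.
Qed.

(** Unimodality without naming a peak. Multiplication by [l] makes [h] grow weakly while it is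
    injective; once surjective it stays so, and [h] decreases weakly from there on. *)
Lemma hilb_unimodal i j k : (i <= j <= k)%N -> (minn (h i) (h k) <= h j)%N.
Proof.
have [l [hl sl]] := SLP.
have up t : mult_injective I l 1 t -> (h t <= h t.+1)%N.
  have [l0|l0] := eqVneq l 0 => inj.
    by rewrite [h t]hilb_eq0 // => p hp; apply: inj => //; rewrite l0 mulr0; case: lI.
  have := dimp_mult_injective hl l0 inj.
  have := dimpI_ge (t + 1) lI (linpred_multiple (l ^+ 1)).
  rewrite (@dimp_multiple _ 1) ?expr1 //.
  have := dimp_hilb I (t + 1); have := dimp_hilb I t; rewrite addn1; lia.
have down t : mult_surjective I l 1 t -> (h t.+1 <= h t)%N.
  have [l0|l0] := eqVneq l 0 => sur.
    rewrite [h t.+1]hilb_eq0 // => p; rewrite -[t.+1]addn1 => hp.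
    by have [g [_]] := sur p hp; rewrite l0 mulr0 subr0.
  have hl1 : l ^+ 1 \is 1.-homog by [].
  have := hilb_mult_surjective hl l0 sur.
  rewrite -(dimp_colon t (expf_neq0 1 l0) hl1 lI) -(dimp_hilb I t) addn1 => le.
  rewrite -(leq_add2l (dimp I t)); apply: leq_trans le; rewrite leq_add2r.
  apply: dimp_le => //; first exact: linpred_colon.
  by move=> p _ Ip; rewrite mulrC; apply: IM.
have downs t n : mult_surjective I l 1 t -> (h (t + n) <= h t)%N.
  elim: n t => [|n IH] t sur; first by rewrite addn0.
  rewrite addnS -addSn; apply: leq_trans (down _ sur).
  by apply: IH; apply: mult_surjectiveS.
move=> /andP [ij jk].
(* A surjective step before [j] gives [h k <= h j]; otherwise all steps from [i] to [j] are
   injective and [h i <= h j]. *)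
have [[t [it tj sur]]|nosur] :=
  classic (exists t, [/\ (i <= t)%N, (t < j)%N & mult_surjective I l 1 t]).
  have surj n : mult_surjective I l 1 (t + n).
    by elim: n => [|n IH]; rewrite ?addn0 // addnS; apply: mult_surjectiveS.
  have := downs _ (k - j)%N (surj (j - t)%N).
  rewrite (subnKC (ltnW tj)) subnKC // => le; exact: leq_trans (geq_minr _ _) le.
apply: leq_trans (geq_minl _ _) _.
have {k jk} : forall n, (i + n <= j)%N -> (h i <= h (i + n))%N.
  elim=> [|n IH] le; first by rewrite addn0.
  apply: leq_trans (IH _) _; first by lia.
  rewrite addnS; apply: up; case: (sl 1%N (i + n)%N isT) => // sur.
  by case: nosur; exists (i + n)%N; split=> //; lia.
by move/(_ (j - i)%N); rewrite subnKC //; apply.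
Qed.

End Ideal.
End Lefschetz.

(** * The generic initial ideal as a function of the Hilbert function *)

Section Gin.
Variable K : fieldType.
Local Notation S := {mpoly K[3]}.

(* dimension of the degree-t elements of the ideal divisible by [ell^c],
   for an ideal with Hilbert function [h] of the quotient and a Lefschetz form [ell] *)
Definition edim (h : nat -> nat) t c :=
  if (c <= t)%N then (dimS K (t - c) - minn (h (t - c)) (h t))%N else 0%N.

(** The candidate for the generic initial ideal: in degree t and x_3-degree c it takes the e(t, c) -
    e(t, c + 1) largest monomials, which are those of smallest x_2-exponent. *)
Definition ginset (h : nat -> nat) (m : 'X_{1..3}) : Prop :=
  (m i1 < edim h (mdeg m) (m i2) - edim h (mdeg m) (m i2).+1)%N.

Lemma dimS0 : dimS K 0 = 1%N.
Proof. by rewrite dimSE. Qed.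

(** The same condition on the x_1-exponent, obtained from [dimS_S]; it involves only [m i0], [n] and
    [t]. For [n = 0] the value of [h] in degree -1 is read as 0. *)
Lemma ginsetE (h : nat -> nat) (m : 'X_{1..3}) (n := (m i0 + m i1)%N) (t := mdeg m) :
  (forall k, h k <= dimS K k)%N ->
  ginset h m <->
  (minn (h n) (h t) <= m i0 + (if n is n'.+1 then minn (h n') (h t) else 0))%N.
Proof.
move=> hle; rewrite /ginset /edim -/t.
have -> : t = (n + m i2)%N by rewrite /t /n mdeg3.
rewrite leq_addl addnK; have hn := hle n.
have -> : (m i1 = n - m i0)%N by rewrite /n; lia.
have : (m i0 <= n)%N by rewrite /n leq_addr.
move: hn; case: n => [|n] hn le.
  rewrite ifN; last by rewrite add0n ltnn.
  by move: hn; rewrite dimS0; lia.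
have hn' := hle n.
rewrite ifT; last by lia.
have -> : (n.+1 + m i2 - (m i2).+1 = n)%N by lia.
rewrite dimS_S; move: hn; rewrite dimS_S; lia.
Qed.

Lemma ginset_almost_revlex (h : nat -> nat) : (forall k, h k <= dimS K k)%N ->
  (forall i j k, i <= j <= k -> minn (h i) (h k) <= h j)%N -> almost_revlex (ginset h).
Proof.
move=> hle uni u v [Ju minu] vu; rewrite revlex_gtE => gt; apply/(ginsetE _ hle).
move: Ju => /(ginsetE _ hle); rewrite vu.
have tv : (mdeg v = v i0 + v i1 + v i2)%N by rewrite mdeg3.
have tu : (mdeg u = u i0 + u i1 + u i2)%N by rewrite mdeg3.
have [e2|ne2] := eqVneq (v i2) (u i2).
  have -> : (v i0 + v i1 = u i0 + u i1)%N by lia.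
  have lt : (u i0 <= v i0)%N by move: gt; rewrite e2 ltnn eqxx /=; lia.
  by move/leq_trans; apply; rewrite leq_add2r.
have lt2 : (v i2 < u i2)%N by move: gt; rewrite (negbTE ne2) /= orbF.
(* By minimality the quotient [w] of [u] by x_3 lies outside the set. *)
move=> Ju; pose w := (u - U_(i2))%MM.
have [w0 w1 w2] : [/\ w i0 = u i0, w i1 = u i1 & w i2 = (u i2).-1].
  by split; rewrite mnmBE mnm1E /= ?subn0 ?subn1.
have nJw : ~ ginset h w.
  move=> Jw; have /mnmP/(_ i2) : w = u.
    by apply: minu => // i; rewrite mnmBE leq_subr.
  by rewrite w2; lia.
have {nJw} : ~ (minn (h (u i0 + u i1)) (h (mdeg u).-1) <=
    u i0 + (if (u i0 + u i1)%N is n'.+1 then minn (h n') (h (mdeg u).-1) else 0))%N.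
  have <- : mdeg w = (mdeg u).-1 by rewrite tu mdeg3 w0 w1 w2; lia.
  by rewrite -w0 -w1 => ?; apply: nJw; apply/(ginsetE _ hle).
move: Ju; set t := mdeg u in vu tu *; set a := u i0 in tu w0 *.
set n := (a + u i1)%N in tu *; set n' := (v i0 + v i1)%N in tv *.
have ltn : (n < n')%N by lia.
have len' : (n' <= t)%N by lia.
clearbody n n'; case: n' ltn len' tv => // n' ltn len' tv.
(* If [h n < h t], unimodality at [t.-1] would put [w] in the set. Hence [h t <= h n], and
   unimodality gives [h t <= h n'] and [h t <= h n'.+1], so both minima in the condition for [v]
   equal [h t]. *)
have U1 := uni n n'.+1 t; have U2 := uni n n' t; have U3 := uni n t.-1 t.
have {}U1 : (minn (h n) (h t) <= h n'.+1)%N by apply: U1; lia.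
have {}U2 : (minn (h n) (h t) <= h n')%N by apply: U2; lia.
have {}U3 : (minn (h n) (h t) <= h t.-1)%N by apply: U3; lia.
case: n ltn tu U1 U2 U3 => [|n] ltn tu U1 U2 U3; first by lia.
have U4 : (minn (h n) (h t) <= h n.+1)%N by apply: uni; lia.
lia.
Qed.

Section Existence.
Hypothesis K0 : [pchar K] =i pred0.
Variables (I : S -> Prop) (h : nat -> nat) (T : nat).
Hypotheses (lI : linpred I) (IM : forall p q, I p -> I (q * p)).
Hypotheses (hI : forall n, hilb I n = h n) (hT : forall n, (T <= n)%N -> h n = 0%N).

(** Two lower bounds hold for every invertible [g]: the space contains x_3^c times the degree
    [t - c] part of the ideal, and it is an intersection of two subspaces of known dimension. *)
Lemma edim_le g t c : g \in unitmx ->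
  (edim h t c <= dimp (fun p => image_ideal g I p /\ van (lowX2 c) p) t)%N.
Proof.
move=> Ug; rewrite /edim; case: (leqP c t) => // ct.
have [n ->] : exists n, t = (n + c)%N by exists (t - c)%N; rewrite subnK.
rewrite addnK; have lV := linpred_image g lI.
have dV k : (dimp (image_ideal g I) k + h k = dimS K k)%N.
  by rewrite dimp_image // -hI dimp_hilb.
have lX := linpred_van K (lowX2 c).
have A : (dimp (image_ideal g I) n <=
    dimp (fun p => image_ideal g I p /\ van (lowX2 c) p) (n + c))%N.
  rewrite -dimp_X2_colon //; apply: dimp_le => //; first exact: linpred_colon.
  by move=> p _ Ip; rewrite mulrC; apply: image_ideal_mul.
have := dimpI_ge (n + c) lV lX.
have -> : dimp (@van K (lowX2 c)) (n + c) = dimS K n.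
  rewrite -(dimp_multiple n (X2_neq0 K c) (X2_homog K c)).
  by apply: (dimp_eq lX (linpred_multiple _)) => p _; apply: van_lowX2P.
move: A; set x := dimp _ (n + c) => A.
have := dV n; have := dV (n + c)%N; lia.
Qed.

Hypothesis SL : exists2 g, g \in unitmx & forall n c,
  (dimp (fun p => image_ideal g I p /\ van (lowX2 c) p) (n + c) <=
   dimS K n - minn (hilb I n) (hilb I (n + c)))%N.

(** For each degree and x_3-degree, moving a Lefschetz form to x_3 and then shearing gives one
    matrix satisfying the upper bound of [initial_idealE]; openness spreads it to general
    matrices. *)
Lemma ginset_is_gin : is_gin I (ginset h).
Proof.
pose r t c := (edim h t c - edim h t c.+1)%N.
(* Finitely many pairs suffice, since from degree [T] on the ideal contains every form. *)
have open (tc : 'I_T * 'I_T) : exists P : {mpoly K[3 * 3]}, P != 0 /\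
    ((tc.2 <= tc.1)%N -> forall g, g \in unitmx -> mxeval P g != 0 ->
     (dimp (fun p => image_ideal g I p /\ van (lowX12 tc.2 (r tc.1 tc.2)) p) tc.1 <=
      edim h tc.1 tc.2.+1)%N).
  case: tc => [[t tT] [c cT]] /=; have [ct|] := leqP c t; last first.
    by exists 1; rewrite oner_neq0.
  have [g0 Ug0 up] := SL.
  have {}up c' : (dimp (fun p => image_ideal g0 I p /\ van (lowX2 c') p) t <= edim h t c')%N.
    rewrite /edim; case: (leqP c' t) => [le|lt].
      by have := up (t - c')%N c'; rewrite subnK // !hI.
    rewrite leqn0 dimv_eq0 -subv0; apply/subvP => v.
    move=> /gpP [|_ vv]; first exact/linpredI/linpred_van/linpred_image.
    rewrite memv0; apply/eqP/val_inj/mpolyP => m /=; rewrite mcoeff0.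
    have [/eqP tm|ne] := boolP (mdeg m == t).
      by apply: vv; move: tm; rewrite mdeg3 /lowX2; lia.
    exact: dhomog_nemf_coeff (dhomog_is_dhomog v) ne.
  have [n En] : exists n, t = (n + c)%N by exists (t - c)%N; rewrite subnK.
  have lV := linpred_image g0 lI.
  (* The upper bound at [c] and the lower bound at [c.+1] limit the drop in dimension to [r t c]. *)
  have [|s Hs] := @shear_witness _ K0 (image_ideal g0 I) n c (r t c) lV.
    rewrite -En; apply: leq_trans (up c) _.
    apply: leq_trans (leq_add (edim_le t c.+1 Ug0) (leqnn _)).
    by rewrite /r -maxnE leq_maxr.
  have [||P P0 HP] := @dimp_image_van_open _ I (lowX12 c (r t c)) t (edim h t c.+1)
    (g0 *m shear s) lI.
  - by rewrite unitmx_mul Ug0 shear_unit.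
  - apply: leq_trans (up c.+1); rewrite En; apply: leq_trans Hs; rewrite -En.
    apply: dimp_le => [||p _ [Ip vp]]; try exact/linpredI/linpred_van/linpred_image.
    by split=> //; apply/image_idealM.
  by exists P; split=> // _ g Ug Pg; apply: HP.
have [P HP] := fin_all_exists open.
exists (\prod_tc P tc); split; first by apply/prodf_neq0 => tc _; case: (HP tc).
move=> g Ug; rewrite rmorph_prod => /prodf_neq0 Pg m.
have lV := linpred_image g lI; have [mT|] := ltnP (mdeg m) T.
  symmetry; apply: (@initial_idealE _ _ (mdeg m) (edim h (mdeg m))) => // c.
    exact: edim_le.
  move=> cm; have cT : (c < T)%N by apply: leq_ltn_trans mT.
  by have [_] := HP (Ordinal mT, Ordinal cT); apply=> //; apply: Pg.
move=> /hT hm0; split=> _.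
  exists 'X_[m]; split; last split.
  - apply: (dimp_full lV) (_ : 'X_[m] \is (mdeg m).-homog); last by rewrite dhomogX.
    by rewrite dimp_image // -(dimp_hilb I) hI hm0 addn0.
  - by exists (mdeg m); rewrite dhomogX.
  split; first by rewrite -msize_poly_eq0 msizeX.
  split=> [|m']; rewrite mcoeffX ?eqxx ?oner_neq0 //.
  by case: (m =P m') => [->|_]; rewrite eqxx.
apply/ginsetE; last by rewrite hm0 minn0.
by move=> k; rewrite -hI leq_subr.
Qed.

(** Two nonempty open subsets of GL_3 meet: the product of their polynomials and the generic
    determinant is nonzero at some matrix. *)
Lemma gin_unique (J J' : 'X_{1..3} -> Prop) : is_gin I J -> is_gin I J' -> forall m, J' m <-> J m.
Proof.
case=> P [P0 HP] [P' [P'0 HP']] m.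
pose X : 'M[{mpoly K[3 * 3]}]_3 := \matrix_(i, j) 'X_(mxvec_index i j).
have detX (v : 'I_(3 * 3) -> K) : (\det X).@[v] = \det (\matrix_(i, j) v (mxvec_index i j)).
  rewrite -det_map_mx; congr (\det _); apply/matrixP => i j.
  by rewrite !mxE; apply: mevalXU.
have X0 : \det X != 0.
  have /eqP := detX (fun k => mxvec (1%:M : 'M[K]_3) 0 k).
  apply: contraTneq => ->; rewrite meval0 (_ : \matrix_(i, j) _ = 1%:M) ?det1.
    by rewrite eq_sym oner_neq0.
  by apply/matrixP => i j; rewrite !mxE mxvecE mxE.
have [v] := mpoly_nonroot K0 (mulf_neq0 (mulf_neq0 P0 P'0) X0).
rewrite !mevalM !mulf_eq0 !negb_or -andbA detX => /and3P [Pv P'v].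
set g := \matrix_(i, j) _ => dg.
have Ug : g \in unitmx by rewrite unitmxE unitfE.
have Eg : (fun k => mxvec g 0 k) =1 v.
  by move=> k; case/mxvec_indexP: k => i j; rewrite mxvecE mxE.
have Pg : P.@[fun k => mxvec g 0 k] != 0 by rewrite (meval_eq _ Eg).
have P'g : P'.@[fun k => mxvec g 0 k] != 0 by rewrite (meval_eq _ Eg).
by rewrite (HP g Ug Pg) (HP' g Ug P'g).
Qed.

End Existence.

(** The additivity relations compute the Hilbert function one generator at a time from the degrees
    alone. *)
Lemma hilb_ideal3_eq (d : 'I_3 -> nat) (f f' : 'I_3 -> S) :
  (forall i, f i \is (d i).-homog) -> regular_seq3 f ->
  (forall i, f' i \is (d i).-homog) -> regular_seq3 f' ->
  forall n, hilb (ideal3 f) n = hilb (ideal3 f') n.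
Proof.
move=> hf rf hf' rf'.
suff : forall k, (k <= 3)%N -> forall n, hilb (ideal_first f k) n = hilb (ideal_first f' k) n.
  by apply.
elim=> [|k IH] lt n; first by rewrite !hilb_ideal_first0.
pose k' := Ordinal lt; have {}IH := IH (ltnW lt).
have [le|lt'] := leqP (d k') n; last first.
  by rewrite (hilb_ideal_first_lt hf lt') (hilb_ideal_first_lt hf' lt') IH.
have := hilb_ideal_firstS hf rf k' (n - d k'); have := hilb_ideal_firstS hf' rf' k' (n - d k').
rewrite subnK // -!IH /= => <-.
by move/addIn.
Qed.

End Gin.

Theorem theorem1p1 (K : fieldType) (hK : [pchar K] =i pred0)
    (d : 'I_3 -> nat) (hd : forall i, (0 < d i)%N)
    (f f' : 'I_3 -> {mpoly K[3]})
    (hf : forall i, f i \is (d i).-homog) (hreg : regular_seq3 f)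
    (hslp : strong_Lefschetz (ideal3 f))
    (hf' : forall i, f' i \is (d i).-homog) (hreg' : regular_seq3 f')
    (hslp' : strong_Lefschetz (ideal3 f')) :
  exists J : 'X_{1..3} -> Prop,
    is_gin (ideal3 f) J /\
    (forall J', is_gin (ideal3 f) J' -> forall m, J' m <-> J m) /\
    is_gin (ideal3 f') J /\
    almost_revlex J.
Proof.
have lI (F : 'I_3 -> {mpoly K[3]}) : linpred (ideal3 F) by apply: linpred_ideal_first.
have IM (F : 'I_3 -> {mpoly K[3]}) p q : ideal3 F p -> ideal3 F (q * p).
  exact: ideal_firstM.
have gin : is_gin (ideal3 f) (ginset K (hilb (ideal3 f))).
  apply: (@ginset_is_gin _ hK _ _ (\sum_i d i)%N) => //.
  - exact: IM.
  - exact: hilb_ideal3_eq0 hf hreg.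
  - exact: lefschetz_change (lI f) (IM f) hslp.
exists (ginset K (hilb (ideal3 f))); split=> //; split; last split.
- by move=> J' gin' m; apply: (gin_unique hK gin gin').
- apply: (@ginset_is_gin _ hK _ _ (\sum_i d i)%N) => //.
  + exact: IM.
  + exact: hilb_ideal3_eq hf' hreg' hf hreg.
  + exact: hilb_ideal3_eq0 hf hreg.
  + exact: lefschetz_change (lI f') (IM f') hslp'.
- apply: ginset_almost_revlex; first by move=> k; rewrite leq_subr.
  exact: hilb_unimodal (lI f) (IM f) hslp.
Qed.
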